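(* Let $G$ be a cactus graph. Then: (1) $G$ is a circle graph. (2) The independence complex $I_G$ is homotopy equivalent to a wedge of spheres.
   Context: Graphs are finite and simple. A cactus graph is a connected graph in which any two cycles have at most one vertex in common. A chord diagram is a circle together with a finite set of chords with pairwise disjoint boundary points. A circle graph is the intersection graph of the chords of some chord diagram: one vertex per chord, two vertices joined by an edge exactly when the two chords intersect. The independence complex $I_G$ of a loopless graph $G$ is the simplicial complex whose simplices are the independent sets of vertices of $G$ (the empty set included); it is identified with its geometric realization. The independence complex of the empty graph is $\{\emptyset\}$, denoted $S^{-1}$. A ''wedge of spheres'' means a finite wedge of spheres $S^{k}$ with $k\ge 0$, formed by successive one-point identifications at arbitrarily chosen base points ($S^0$ is two points, so the result may be disconnected); the empty wedge is a point, so contractible complexes count as (empty) wedges of spheres; the empty complex $S^{-1}$ is also allowed. *)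

(* Defs.v *)
From HB Require Import structures.
From mathcomp Require Import all_boot all_order all_algebra.
From mathcomp Require Import all_classical all_reals topology normedtype.
From mathcomp Require Import homotopy.

Set Implicit Arguments.
Unset Strict Implicit.
Unset Printing Implicit Defensive.

Import Order.TTheory GRing.Theory Num.Theory.
Import numFieldNormedType.Exports.

Local Open Scope classical_set_scope.
Local Open Scope ring_scope.

(* A finite simple graph is a symmetric irreflexive relation on a finType. *)

Section graphs.
Context {V : finType}.

Definition graph_connected (e : rel V) : Prop := forall x y : V, connect e x y.

(* A cycle is a subgraph; a sequence of vertices traversing it is determined
   by the cycle only up to rotation and reversal, so that two traversals are
   the same cycle exactly when they have the same set of edges. *)
Definition graph_cycle (e : rel V) (c : seq V) : bool :=
  ucycleb e c && (2 < size c)%N.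

Definition cycle_edges (c : seq V) : {set {set V}} :=
  [set [set x; next c x] | x in c]%SET.

Definition cycle_vertices (c : seq V) : {set V} := [set x in c]%SET.

Definition cactus (e : rel V) : Prop :=
  graph_connected e /\
  forall c d : seq V, graph_cycle e c -> graph_cycle e d ->
    cycle_edges c != cycle_edges d ->
    (#|cycle_vertices c :&: cycle_vertices d| <= 1)%N.

Definition independent (e : rel V) (A : {set V}) : bool :=
  [forall x in A, forall y in A, ~~ e x y].

Definition independence_complex (e : rel V) : {set {set V}} :=
  [set A | independent e A]%SET.

End graphs.

(* The unit sphere of R^n is S^(n-1); in particular S^(-1) is empty. *)
Definition unit_sphere (R : realType) (n : nat) : set 'rV[R]_n :=
  [set x | \sum_i x 0 i ^+ 2 = 1].

Definition segment (R : realType) (n : nat) (p q : 'rV[R]_n) : set 'rV[R]_n :=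
  [set (1 - t) *: p + t *: q | t in `[0, 1]].

(* A finite family of chords of the unit circle, the chord v joining
   endpoint (v, false) to endpoint (v, true). *)
Record chord_diagram (R : realType) (V : finType) := ChordDiagram {
  endpoint : V * bool -> 'rV[R]_2;
  endpoint_circle : forall v, unit_sphere (endpoint v);
  endpoint_inj : injective endpoint }.

Definition chord (R : realType) (V : finType) (D : chord_diagram R V) (v : V) :
    set 'rV[R]_2 :=
  segment (endpoint D (v, false)) (endpoint D (v, true)).

Definition circle_graph (R : realType) (V : finType) (e : rel V) : Prop :=
  exists D : chord_diagram R V, forall u v : V,
    e u v <-> u != v /\ chord D u `&` chord D v !=set0.

(* Geometric realization in barycentric coordinates. The vertices are those v
   for which [set v] is in K. *)
Definition geometric_realization (R : realType) (V : finType)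
    (K : {set {set V}}) : topologicalType :=
  set_type [set w : {ptws V -> R} |
    [/\ forall v, 0 <= w v, \sum_v w v = 1 & [set v | w v != 0]%SET \in K]].

Definition homotopic (R : realType) (X Y : topologicalType) (f g : X -> Y) :
    Prop :=
  exists H : X * R -> Y,
    [/\ {within [set: X] `*` `[0, 1], continuous H},
        forall x, H (x, 0) = f x & forall x, H (x, 1) = g x].

Definition homotopy_equivalent (R : realType) (X Y : topologicalType) : Prop :=
  exists (f : X -> Y) (g : Y -> X),
    [/\ continuous f, continuous g,
        homotopic R (g \o f) id & homotopic R (f \o g) id].

Definition wedge2 (X Y : topologicalType) (x : X) (y : Y) : topologicalType :=
  @wedge bool (fun b => if b then X else Y)
    (fun b => if b return (if b then X else Y) then x else y).

(* Since base points are needed to form wedge2, the empty sphere S^(-1) only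
   occurs on its own. The wedge points may be distinct. *)
Inductive wedge_of_spheres (R : realType) : topologicalType -> Prop :=
| wedge_point : wedge_of_spheres R (set_type [set (0 : R)])
| wedge_sphere n : wedge_of_spheres R (set_type (@unit_sphere R n))
| wedge_join (X Y : topologicalType) (x : X) (y : Y) :
    wedge_of_spheres R X -> wedge_of_spheres R Y ->
    wedge_of_spheres R (wedge2 x y).

(* Main.v *)
Require Import Defs.
From mathcomp Require Import all_boot all_order all_algebra.
From mathcomp Require Import all_classical all_reals topology normedtype.
From mathcomp Require Import homotopy zify ring lra.

Set Implicit Arguments.
Unset Strict Implicit.
Unset Printing Implicit Defensive.

(** A nonempty set of vertices of a cactus induces a subgraph with an isolated
vertex, a leaf, or a cycle on which only one vertex has further neighbours
([cactus_end]): when all degrees are at least two, a smallest set [T] cut off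
by a vertex [w] is, together with [w], two-connected; this piece contains a
cycle, and anything more would be an ear or a chord of this cycle, hence would
give two cycles with two common vertices. Both parts follow by peeling off such
ends.

For the first part, the picture of the end is inserted next to one endpoint of
the chord of [w], so short that only this chord reaches it
([cactus_positions]). This yields positions on a line; these are carried to
the circle by a rational parametrization, and two chords meet exactly when
their pairs of positions interleave ([chords_meet]).

For the second part, the independence complex is the clique complex of the
complement. Clique complexes keep their homotopy type when an edge is removed
whose ends and common neighbours are all joined to some further vertex (the
apex), or when a dominated vertex is removed ([equiv]). Both moves are
realized geometrically by letting the mass on the removed simplices flow
linearly towards the apex ([collapse_homotopy_equivalent]), and they reduce
every end. An isolated vertex makes the complex a cone, and a leaf turns it
into the suspension of a smaller one. A pendant cycle of length four folds to
a leaf, and three vertices can be taken out of a longer one at the cost of a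
suspension. For a pendant triangle with further vertices [a] and [b] the
complex is the union of cones from [a], [b] and [w], where the bases of the
first two cones agree and contain that of the third. Such a union is a wedge
of two suspensions ([triangle_suspensions]).

Suspensions and wedges of wedges of spheres are again of this kind. This is
seen on the level of complexes, where splitting a vertex in two
([equiv_split]) moves a suspension off a wedge ([wsusp_zip]). What remains at
the end is a complex of cross-polytopes, each attached at one vertex to those
before it. It is homeomorphic to a wedge of round spheres: cross-polytopes are
matched with spheres by radial projection, and two complexes that share one
vertex form a wedge ([attached_spheres_wedge], [glue_wedge]). *)

(** * The ends of a cactus *)

Section Cactus.
Variables (V : finType) (e : rel V).
Hypotheses (es : symmetric e) (ei : irreflexive e).

(** What hangs from [w]: a leaf when [p] has one entry, and otherwise a cycle
    [w :: p] in which only [w] has further neighbours in [S]. *)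
Record pendant (S : {set V}) (w : V) (p : seq V) : Prop := Pendant {
  pendant_uniq : uniq p;
  pendant_size : 0 < size p;
  pendant_sub : {subset p <= S};
  pendant_root : w \in S;
  pendant_rootN : w \notin p;
  pendant_path : forall i j, i < size p -> j < size p ->
    e (nth w p i) (nth w p j) = (i.+1 == j) || (j.+1 == i);
  pendant_rootE : forall i, i < size p ->
    e w (nth w p i) = (i == 0) || (i.+1 == size p);
  pendant_out : forall x y, x \in p -> y \in S -> e x y -> y \in w :: p }.

Hypothesis ecactus : forall c d : seq V, graph_cycle e c -> graph_cycle e d ->
    cycle_edges c != cycle_edges d ->
    #|cycle_vertices c :&: cycle_vertices d| <= 1.

Lemma cycle_edges_vertices (c d : seq V) :
  cycle_edges c = cycle_edges d -> c =i d.
Proof.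
have sub (a b : seq V) : cycle_edges a = cycle_edges b -> {subset a <= b}.
  move=> E x xa; have : [set x; next a x]%SET \in cycle_edges a.
    by apply/imsetP; exists x.
  rewrite E => /imsetP[y yb Exy]; have : x \in [set y; next b y]%SET.
    by rewrite -Exy !inE eqxx.
  by rewrite !inE => /orP[]/eqP-> //; rewrite mem_next.
by move=> E x; apply/idP/idP; apply: sub.
Qed.

(** The cactus condition in terms of vertex sets, the form that ears and chords
    of a cycle contradict. *)
Lemma cactus_cycles_meet (c d : seq V) x y :
  graph_cycle e c -> graph_cycle e d -> x != y ->
  x \in c -> x \in d -> y \in c -> y \in d -> c =i d.
Proof.
move=> cc cd xy xc xd yc yd.
apply: cycle_edges_vertices; apply/eqP/negP => /negP ne.
have := ecactus cc cd ne; rewrite leqNgt => /negP[].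
by apply/card_gt1P; exists x, y; rewrite !inE xc xd yc yd.
Qed.

(** An ear would split the cycle into two cycles that share both feet. *)
Lemma cactus_no_ear z x (D1 D2 q : seq V) :
  graph_cycle e (z :: D1 ++ x :: D2) ->
  path e x (rcons q z) -> uniq q ->
  {in q, forall y, y \notin z :: D1 ++ x :: D2} ->
  (q = [::] -> (D1 != [::]) && (D2 != [::])) -> False.
Proof.
set D := z :: D1 ++ x :: D2 => cD pq uq qD q0.
have := cD => /andP[/andP[cyc uD] _].
have zx : z != x.
  by move: uD; rewrite /D /= mem_cat inE !negb_or => /andP[/and3P[]].
have c' : graph_cycle e (z :: D1 ++ x :: q).
  apply/andP; split; last first.
    rewrite /= size_cat /=; case: q q0 {pq uq qD} => [/(_ erefl)|y q _].
      by case: (D1) => //= a l _; lia.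
    by rewrite /=; lia.
  apply/andP; split.
    rewrite /cycle rcons_cat cat_path /=.
    move: cyc; rewrite /D /cycle rcons_cat cat_path /= => /andP[-> /andP[-> _]].
    by rewrite /=.
  have -> : z :: D1 ++ x :: q = (z :: rcons D1 x) ++ q by rewrite /= cat_rcons.
  rewrite cat_uniq uq andbT; apply/andP; split.
    by move: uD; rewrite /D -cat_rcons -cat_cons cat_uniq => /and3P[].
  apply/hasPn => y /qD; apply: contra => /=.
  by rewrite /D -cat_rcons !inE mem_cat => /orP[->//|->]; rewrite orbT.
have zD : z \in D by rewrite inE eqxx.
have xD : x \in D by rewrite inE mem_cat inE eqxx !orbT.
have E : z :: D1 ++ x :: q =i D.
  apply: (cactus_cycles_meet c' cD zx) => //; first by rewrite inE eqxx.
  by rewrite inE mem_cat inE eqxx !orbT.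
case: q pq uq qD q0 c' E => [|y q] pq uq qD q0 c' E.
  have {q0} /andP[_ D2n] := q0 erefl.
  move: uD; rewrite /D -cat_rcons -cat_cons cat_uniq => /and3P[_ /hasPn h _].
  move: E; rewrite /D; case: {cD cyc pq qD zD xD D} D2 D2n h => // a l _ h E.
  have := h a (mem_head _ _); rewrite -cats1 -cat_cons E.
  by rewrite !inE mem_cat !inE eqxx !orbT.
have := qD y; rewrite inE eqxx => /(_ isT); rewrite -E.
by rewrite inE mem_cat !inE eqxx !orbT.
Qed.

(** [T] is a union of components of [S] minus [w]. *)
Definition separated (S : {set V}) (w : V) (T : {set V}) : Prop :=
  [/\ w \in S, T \subset S, w \notin T, T != finset.set0 &
      forall x y, x \in T -> y \in S -> e x y -> (y \in T) || (y == w)].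

Lemma path_first_hit (D : seq V) (y : V) (s : seq V) :
  path e y s -> last y s \in D -> y \notin D ->
  exists q z s', [/\ s = rcons q z ++ s', z \in D & {in q, forall a, a \notin D}].
Proof.
elim: s y => [|a s IH] y /=; first by move=> _ ->.
case/andP=> _ pas; have [aD _ _|aD l _] := boolP (a \in D).
  by exists [::], a, s.
have [q [z [s' [-> zD qD]]]] := IH a pas l aD.
exists (a :: q), z, s'; split=> // b; rewrite inE => /orP[/eqP->//|]; exact: qD.
Qed.

Definition induced (B : {set V}) : rel V :=
  [rel x y | [&& e x y, x \in B & y \in B]].

Lemma path_induced (B : {set V}) x s : path (induced B) x s -> path e x s /\ {subset s <= B}.
Proof.
elim: s x => //= a s IH x /andP[/and3P[exa xB aB] /IH[ps sB]].
by rewrite exa ps; split=> // b; rewrite inE => /orP[/eqP->|/sB].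
Qed.

Lemma connect_induced_mem (B : {set V}) x y : x \in B -> connect (induced B) x y -> y \in B.
Proof.
move=> xB /connectP[s ps ->]; have [_ sB] := path_induced ps.
by have := mem_last x s; rewrite inE => /orP[/eqP->|/sB].
Qed.

Lemma connect_induced_sym (B : {set V}) x y :
  connect (induced B) x y = connect (induced B) y x.
Proof.
apply: sym_connect_sym => a b; rewrite /induced /=.
by rewrite (es a b) [(a \in B) && _]andbC.
Qed.

Section Minimal.
Variables (S : {set V}) (w : V) (T : {set V}).
Hypotheses (sepT : separated S w T)
  (minT : forall w' T', separated S w' T' -> #|T| <= #|T'|)
  (deg2 : forall x, x \in S -> exists y z,
     [/\ y \in S, z \in S, y != z, e x y & e x z]).

Let B := w |: T.
Let wS : w \in S. Proof. by case: sepT. Qed.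
Let TS : {subset T <= S}. Proof. by case: sepT => _ /fintype.subsetP. Qed.
Let wT : w \notin T. Proof. by case: sepT. Qed.
Let BS : {subset B <= S}.
Proof. by move=> x; rewrite !inE => /orP[/eqP->|/TS]. Qed.
Let Tnbr x y : x \in T -> y \in S -> e x y -> y \in B.
Proof. by case: sepT => _ _ _ _ h xT yS /(h x y xT yS); rewrite !inE orbC. Qed.

(** If [w] had no neighbour in [T], then any vertex [t] of [T] would separate
    the smaller set [T :\ t]. *)
Lemma minimal_attached : exists2 t, t \in T & e w t.
Proof.
case: (pickP [pred t in T | e w t]) => [t /andP[]|no]; first by exists t.
case: sepT => _ _ _ /set0Pn[t tT] Tcl.
have [y [_ [yS _ _ ety _]]] := deg2 (TS tT).
have noT x : x \in T -> e x w = false by move=> xT; have := no x; rewrite /= xT es.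
have Te x z : x \in T -> z \in S -> e x z -> z \in T.
  by move=> xT zS xz; case/orP: (Tcl x z xT zS xz) => // /eqP zw; rewrite zw noT in xz.
have sep' : separated S t (T :\ t).
  split; rewrite ?TS //.
  - by apply/fintype.subsetP => x; rewrite !inE => /andP[_ /TS].
  - by rewrite !inE eqxx.
  - apply/set0Pn; exists y; rewrite !inE (Te t) // andbT.
    by apply/eqP => yt; rewrite yt ei in ety.
  - move=> x z; rewrite !inE => /andP[_ xT] zS /(Te x z xT zS) ->.
    by case: (z == t).
by have := minT sep'; rewrite leqNgt (cardsD1 t T) tT ltnSn.
Qed.

(** A component of [B :\ x] that misses [w] is separated from the rest of [S]
    by [x] alone, so by minimality it has as many elements as [T]: this is
    impossible for [x] in [T], and for [x = w] the component is [T] itself. *)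
Lemma minimal_biconnected x y z : x \in B -> y \in B :\ x -> z \in B :\ x ->
  connect (induced (B :\ x)) y z.
Proof.
move=> xB.
pose cp y := finset (connect (induced (B :\ x)) y).
have cpB a : a \in B :\ x -> cp a \subset B :\ x.
  by move=> aB; apply/fintype.subsetP => b; rewrite inE; exact: connect_induced_mem.
have cpa a : a \in cp a by rewrite inE connect0.
have cpS a : a \in B :\ x -> w \notin cp a -> separated S x (cp a).
  move=> aB wa; have cpT b : b \in cp a -> (b \in T) && (b != x).
    move=> bc; have := fintype.subsetP (cpB a aB) b bc; rewrite !inE.
    by case: (b =P w) bc wa => [-> -> //|_ _ _ /andP[-> /= ->]].
  split; first exact: BS.
  - by apply/fintype.subsetP => b /cpT/andP[/TS].
  - by apply/negP => /cpT; rewrite eqxx andbF.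
  - by apply/set0Pn; exists a.
  - move=> b c bc cS ebc; have /andP[bT bx] := cpT b bc.
    have cB := Tnbr bT cS ebc; case: (c =P x) => [->|/eqP cx]; rewrite ?orbT ?orbF //.
    move: (bc); rewrite !inE => h; apply: connect_trans h _; apply: connect1.
    by rewrite /induced /= ebc !in_setD1 bx cx cB setU1r.
have key a : a \in B :\ x -> (x == w -> cp a = T) /\ (x != w -> w \in cp a).
  move=> aB; split => [/eqP xw|xw].
    have wcp : w \notin cp a.
      by apply/negP => /(fintype.subsetP (cpB a aB)); rewrite !inE xw eqxx.
    apply/eqP; rewrite eqEcard (minT (cpS a aB wcp)) andbT.
    apply/fintype.subsetP => b /(fintype.subsetP (cpB a aB)); rewrite !inE xw.
    by case: eqP.
  have xT : x \in T by move: xB; rewrite !inE (negbTE xw).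
  case: (boolP (w \in cp a)) => // wcp; have := minT (cpS a aB wcp).
  suff : cp a \proper T by move=> /proper_card; rewrite ltnNge => /negP.
  apply/properP; split; last first.
    by exists x => //; apply/negP => /(fintype.subsetP (cpB a aB)); rewrite !inE eqxx.
  apply/fintype.subsetP => b bc; have := fintype.subsetP (cpB a aB) b bc; rewrite !inE.
  by case: (b =P w) bc wcp => [-> -> //|_ _ _ /andP[]].
move=> yB zB; case: (eqVneq x w) => [xw|xw].
  have [/(_ _)/eqP] := key y yB; rewrite xw eqxx => /(_ isT)/eqP cT _.
  have zT : z \in T by move: zB; rewrite !inE xw; case: eqP.
  by rewrite -cT inE xw in zT *.
have [_ /(_ xw)] := key y yB; rewrite inE => yw.
have [_ /(_ xw)] := key z zB; rewrite inE => zw.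
by apply: connect_trans yw _; rewrite connect_induced_sym.
Qed.

(** A neighbour [t] of [w] has another neighbour [t'], and a path from [t'] to [w]
    that avoids [t] closes up to a cycle. *)
Lemma minimal_cycle : exists p, [/\ graph_cycle e (w :: p) & {subset p <= T}].
Proof.
have [t tT ewt] := minimal_attached.
have tB : t \in B by rewrite !inE tT orbT.
have wB : w \in B by rewrite !inE eqxx.
have tw : t != w by apply: contraNneq wT => <-.
have [t' [t't t'w et']] : exists t', [/\ t' \in T, t' != w & e t t'].
  have [y [z [yS zS yz ey ez]]] := deg2 (TS tT).
  have := Tnbr tT yS ey; have := Tnbr tT zS ez; rewrite !inE.
  case: (eqVneq y w) => [yw|yw] /=; last by exists y.
  case: (eqVneq z w) => [zw|zw] /=; first by rewrite yw zw eqxx in yz.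
  by exists z.
have t't' : t' != t by apply: contraTneq et' => ->; rewrite ei.
have /connectP[s0 ps0 l0] : connect (induced (B :\ t)) t' w.
  apply: minimal_biconnected => //; rewrite !inE ?t't' ?t't ?orbT //.
  by rewrite eqxx eq_sym tw.
case: (shortenP ps0) l0 => s ps us _ ls.
have [pe sB] := path_induced ps.
have cyc : graph_cycle e (t :: t' :: s).
  apply/andP; split; last first.
    by case: (s) ls => //= wt'; rewrite wt' eqxx in t'w.
  apply/andP; split.
    by rewrite /cycle rcons_path /= et' pe -ls ewt.
  rewrite cons_uniq us andbT inE negb_or eq_sym t't' /=.
  by apply/negP => /sB; rewrite !inE eqxx.
have wc : w \in t :: t' :: s by rewrite inE ls mem_last orbT.
have [i p Ep] := rot_to wc.
have cyc' : graph_cycle e (w :: p).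
  move: cyc; rewrite /graph_cycle /ucycleb -Ep.
  by rewrite rot_cycle rot_uniq size_rot.
exists p; split => // x xp.
have : x \in w :: p by rewrite inE xp orbT.
rewrite -Ep mem_rot => xc.
have : x \in B.
  move: xc; rewrite !inE => /or3P[/eqP->|/eqP->|/sB]; rewrite ?tT ?t't ?orbT //.
  by rewrite !inE => /andP[].
case/andP: cyc' => /andP[_ /= /andP[wp _]] _.
by rewrite !inE => /orP[/eqP xw|//]; rewrite -xw xp in wp.
Qed.

(** Since [w |: T] stays connected when a vertex is removed, a vertex of [T] off
    the cycle, or a chord, would give an ear. *)
Lemma minimal_pendant : exists p, pendant S w p.
Proof.
have [p [cyc pT]] := minimal_cycle.
have sz : 1 < size p by case/andP: cyc.
have := cyc => /andP[/andP[cy /= /andP[wp up]] _].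
have DB : {subset w :: p <= B}.
  by move=> x; rewrite !inE => /orP[->//|/pT ->]; rewrite orbT.
have cover y : y \in T -> y \in p.
  move=> yT; apply/negP => /negP yp.
  have yw : y != w by apply: contraNneq wT => <-.
  have yD : y \notin w :: p by rewrite inE negb_or yw.
  case: p => // a l in pT cyc sz cy wp up yp DB yD *.
  have aT : a \in T by apply: pT; rewrite inE eqxx.
  have aw : a != w by apply: contraNneq wT => <-.
  (* The first vertex [x] of the cycle reached from [y], avoiding [w], has a
     neighbour [y'] off the cycle. *)
  have [x [y' [xD y'B y'D eyx]]] : exists x y',
      [/\ x \in w :: a :: l, y' \in B, y' \notin w :: a :: l & e y' x].
    have /connectP[s ps ls] : connect (induced (B :\ w)) y a.
      apply: minimal_biconnected; rewrite !inE ?eqxx // ?aw ?aT ?yw ?yT ?orbT //.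
    have [pe sB] := path_induced ps.
    have := @path_first_hit (w :: a :: l) _ _ pe; rewrite -ls inE mem_head orbT => /(_ isT yD).
    case=> q [z [s' [Es zD qD]]]; exists z, (last y q); split => //.
    - have := mem_last y q; rewrite inE => /orP[/eqP->|lq].
        by rewrite !inE yT orbT.
      by have := sB (last y q); rewrite Es mem_cat mem_rcons inE lq orbT => /(_ isT) /setD1P[].
    - have := mem_last y q; rewrite inE => /orP[/eqP->//|]; exact: qD.
    - by move: pe; rewrite Es cat_path rcons_path => /andP[/andP[]].
  have [u [uD ux]] : exists u, u \in w :: a :: l /\ u != x.
    case: (eqVneq w x) => [<-|wx]; first by exists a; rewrite !inE eqxx orbT.
    by exists w; rewrite inE eqxx.
  have xB := DB _ xD.
  have y'x : y' != x by apply: contraNneq y'D => ->.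
  have /connectP[s0 ps0 l0] : connect (induced (B :\ x)) y' u.
    by apply: minimal_biconnected => //; rewrite in_setD1 ?y'x ?ux ?y'B ?DB.
  case: (shortenP ps0) l0 => s ps us _ ls.
  have [pe sB] := path_induced ps.
  have := @path_first_hit (w :: a :: l) _ _ pe; rewrite -ls => /(_ uD y'D).
  case=> q [z [s' [Es zD qD]]].
  have zx : z != x.
    by have := sB z; rewrite Es mem_cat mem_rcons inE eqxx => /(_ isT) /setD1P[].
  have [i D' ED] := rot_to zD.
  have cyc' : graph_cycle e (z :: D').
    move: cyc; rewrite /graph_cycle /ucycleb -ED.
    by rewrite rot_cycle rot_uniq size_rot.
  have mD b : (b \in z :: D') = (b \in w :: a :: l) by rewrite -ED mem_rot.
  have xD' : x \in D' by move: xD; rewrite -mD inE eq_sym (negbTE zx).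
  case/splitPr: D' / xD' ED cyc' mD => D1 D2 _ cyc' mD.
  apply: (@cactus_no_ear z x D1 D2 (y' :: q)) => //.
  - by rewrite /= es eyx; move: pe; rewrite Es cat_path => /andP[].
  - by move: us; rewrite Es -cat_cons -rcons_cons cat_uniq rcons_uniq => /andP[/andP[]].
  - by move=> b; rewrite inE mD => /orP[/eqP->//|]; exact: qD.
exists p; split => //; first by case: (p) sz.
- by move=> x /pT/TS.
- (* A chord between path vertices is an ear without inner vertex. *)
  have half i j : i < j -> j < size p ->
      e (nth w p i) (nth w p j) = (i.+1 == j).
    move=> ij jp; have ip : i < size p by apply: ltn_trans jp.
    apply/idP/eqP => [eij|Ej]; last first.
      subst j.
      move: cy; rewrite /cycle /= rcons_path => /andP[+ _].
      by move/(pathP w)/(_ i.+1); rewrite /= ; apply; lia.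
    apply/eqP/negP => /negP ne.
    set z := nth w p i in eij; set x := nth w p j in eij.
    have Ep : p = take i p ++ z :: drop i.+1 p by rewrite -drop_nth ?cat_take_drop.
    have lt_sub : j - i.+1 < size p - i.+1 by rewrite ltn_sub2r // (leq_ltn_trans ij).
    have Ed : drop i.+1 p = take (j - i.+1) (drop i.+1 p) ++ x :: drop j.+1 p.
      rewrite -size_drop in lt_sub.
      rewrite -[LHS](cat_take_drop (j - i.+1)) (drop_nth w lt_sub).
      by rewrite nth_drop subnKC // drop_drop addSn subnK.
    set D1 := take (j - i.+1) _ in Ed; set D2 := drop j.+1 p in Ed.
    apply: (@cactus_no_ear z x D1 (D2 ++ w :: take i p) [::]) => //=.
    + have : graph_cycle e (rot i.+1 (w :: p)).
        by move: cyc; rewrite /graph_cycle /ucycleb rot_cycle rot_uniq size_rot.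
      have -> : rot i.+1 (w :: p) = z :: D1 ++ x :: D2 ++ w :: take i p.
        by rewrite /rot /= (drop_nth w ip) -/z Ed /= -catA.
      by [].
    + by rewrite es eij.
    + move=> _; apply/andP; split; last by case: (D2).
      rewrite -size_eq0 size_takel ?size_drop ?(ltnW lt_sub) //.
      by rewrite subn_eq0 -ltnNge ltn_neqAle ne.
  move=> i j ip jp; case: (ltngtP i j) => ij.
  + by rewrite half // [j.+1 == i](gtn_eqF (ltnW _)) ?orbF.
  + by rewrite es half // [i.+1 == j](gtn_eqF (ltnW _)).
  + by rewrite ij ei gtn_eqF.
- move=> i ip; apply/idP/idP => [ewi|].
    apply/negP => /negP; rewrite negb_or => /andP[i0 isz].
    set x := nth w p i in ewi.
    have Ep : p = take i p ++ x :: drop i.+1 p by rewrite -drop_nth ?cat_take_drop.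
    apply: (@cactus_no_ear w x (take i p) (drop i.+1 p) [::]) => //=.
    + by rewrite -Ep.
    + by rewrite es ewi.
    + move=> _; rewrite -!size_eq0 size_drop size_takel; last exact: ltnW.
      by rewrite i0 subn_eq0 -ltnNge ltn_neqAle isz.
  move: cy; rewrite /cycle /= rcons_path => /andP[pp lp].
  case/orP => /eqP Ei.
    by move/(pathP w)/(_ 0): pp; rewrite Ei /=; apply; lia.
  have -> : i = (size p).-1 by rewrite -Ei.
  by rewrite es nth_last.
- move=> x y xp yS exy; have := Tnbr (pT x xp) yS exy; rewrite !inE.
  by case: eqP => //= _ /cover.
Qed.
End Minimal.

(** If all degrees are at least two, a separated set of least size together with
    its separating vertex is a cycle: it is a leaf of the block tree. *)
Lemma cactus_end (S : {set V}) : S != finset.set0 ->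
  (exists2 x, x \in S & forall y, y \in S -> ~~ e x y) \/
  (exists w p, pendant S w p).
Proof.
move=> S0.
case: (boolP [exists x in S, [forall y in S, ~~ e x y]]) => [|noiso].
  by case/exists_inP => x xS /forall_inP h; left; exists x.
right; case: (boolP [exists x in S, exists w in S,
    e x w && [forall y in S, e x y ==> (y == w)]]) => [|noleaf].
  case/exists_inP => x xS /exists_inP[w wS /andP[exw /forall_inP h]].
  exists w, [:: x]; split => //=.
  - by move=> y; rewrite inE => /eqP->.
  - by rewrite inE; apply: contraTneq exw => ->; rewrite ei.
  - by case=> [|i]; case=> [|j] //= _ _; rewrite ei.
  - by case=> //= _; rewrite es.
  - by move=> a y; rewrite !inE => /eqP-> yS exy; rewrite (implyP (h y yS) exy).
have deg2 x : x \in S -> exists y z, [/\ y \in S, z \in S, y != z, e x y & e x z].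
  move=> xS; move: noiso; rewrite negb_exists_in => /forall_inP/(_ x xS).
  rewrite negb_forall_in => /exists_inP[y yS]; rewrite negbK => exy.
  move: noleaf; rewrite negb_exists_in => /forall_inP/(_ x xS).
  rewrite negb_exists_in => /forall_inP/(_ y yS); rewrite exy /=.
  rewrite negb_forall_in => /exists_inP[z zS]; rewrite negb_imply => /andP[exz zy].
  by exists y, z; rewrite eq_sym.
have sep0 : exists w T, separated S w T.
  have [s sS] := set0Pn _ S0; have [y [_ [yS _ _ esy _]]] := deg2 s sS.
  exists s, (S :\ s); split; rewrite ?subsetDl ?setD11 //.
    by apply/set0Pn; exists y; rewrite !inE yS andbT; apply: contraTneq esy => ->; rewrite ei.
  by move=> a b _ bS _; rewrite !inE bS andbT orNb.
have {sep0} [w [T [sepT minT]]] : exists w T, separated S w T /\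
    forall w' T', separated S w' T' -> #|T| <= #|T'|.
  have [w0 [T0]] := sep0; elim/ltn_ind: {T0}#|T0| {-2}T0 (erefl #|T0|) w0 => n IH T En w sepT.
  have [[w' [T' [s' l']]]|h] := EM (exists w' T', separated S w' T' /\ #|T'| < #|T|).
    by apply: (IH #|T'| _ T' erefl w'); rewrite // -En.
  exists w, T; split => // w' T' s'; rewrite leqNgt; apply/negP => l'.
  by apply: h; exists w', T'.
by have [p pp] := minimal_pendant sepT minT deg2; exists w, p.
Qed.

End Cactus.

(** * Interleaving pairs of positions *)

Definition between (a b x : nat) : bool := (a < x < b) || (b < x < a).

(** On a circle, being separated by a pair of points is a symmetric relation
    between pairs. *)
Lemma between_cross_sym a b c d : a != c -> a != d -> b != c -> b != d ->
  (between a b c != between a b d) = (between c d a != between c d b).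
Proof.
rewrite /between => ac ad bc bd.
lia.
Qed.

Lemma ltn_scale M a b x y : a < M -> b < M ->
  (M * x + a < M * y + b) = (x < y) || (x == y) && (a < b).
Proof.
move=> aM bM; case: (ltngtP x y) => [xy|xy|->] /=; last by rewrite ltn_add2l.
- by nia.
- by apply/negbTE; rewrite -leqNgt; nia.
Qed.

Section Words.
Variables (V : finType) (e : rel V).
Hypotheses (es : symmetric e) (ei : irreflexive e).

Definition interleave (pos : V -> bool -> nat) (u v : V) : bool :=
  between (pos u false) (pos u true) (pos v false)
  != between (pos u false) (pos u true) (pos v true).

(** A double occurrence word for the subgraph induced on [S]. *)
Definition positions (S : {set V}) (pos : V -> bool -> nat) : Prop :=
  (forall u v s t, u \in S -> v \in S -> pos u s = pos v t -> u = v /\ s = t) /\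
  (forall u v, u \in S -> v \in S -> u != v -> e u v = interleave pos u v).

(** Scaling the positions of [S] by [M] makes room for a picture [q] of [P] at
    any position [x]: the picture falls between the endpoints on either side of
    [x], and the endpoint at [x] itself, if there is one, takes the place [h] in
    it. Only a chord with an endpoint at [x] can then meet a chord of [P]. *)
Lemma positions_insert (S P : {set V}) pos q (x M h : nat) :
  positions S pos -> positions P q -> (forall u, u \in P -> u \notin S) ->
  h < M -> (forall u s, u \in P -> q u s < M) -> (forall u s, u \in P -> q u s != h) ->
  (forall u v, u \in P -> v \in S ->
     e u v = [exists s, pos v s == x] && between (q u false) (q u true) h) ->
  positions (P :|: S) (fun u s => if u \in P then M * x + q u s else M * pos u s + h).
Proof.
move=> [posi pose] [qi qe] PS hM qM qh eh.
set pos' := fun u s => _.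
have pos'P u s : u \in P -> pos' u s = M * x + q u s by rewrite /pos' => ->.
have pos'S u s : u \in S -> pos' u s = M * pos u s + h.
  by rewrite /pos'; case: ifP => // /PS/negbTE->.
have neq u v s t : u \in P -> v \in S -> pos' u s != pos' v t.
  move=> uP vS; rewrite pos'P // pos'S //; apply/negP => /eqP E.
  have := congr1 (modn^~ M) E; rewrite ![M * _]mulnC !modnMDl !modn_small ?qM //.
  by move=> qE; have := qh u s uP; rewrite qE eqxx.
have betweenP u v s : u \in P -> v \in S ->
    between (pos' u false) (pos' u true) (pos' v s) =
    (pos v s == x) && between (q u false) (q u true) h.
  move=> uP vS; rewrite ![pos' u _]pos'P // pos'S // /between !ltn_scale ?qM // (eq_sym _ x).
  by case: (ltngtP x (pos v s)) => //=; rewrite ?andbF.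
split.
  move=> u v s t; rewrite !inE => /orP[uP|uS] /orP[vP|vS] E.
  - by apply: qi => //; move: E; rewrite !pos'P // => /addnI.
  - by have := neq u v s t uP vS; rewrite E eqxx.
  - by have := neq v u t s vP uS; rewrite E eqxx.
  - apply: posi => //; move: E; rewrite !pos'S // => /addIn/eqP.
    by rewrite eqn_pmul2l ?(leq_ltn_trans _ hM) // => /eqP.
have cross u v : u \in P -> v \in S -> interleave pos' u v = e u v.
  move=> uP vS; rewrite /interleave !betweenP // eh //.
  have [xf|xf] := eqVneq (pos v false) x.
    have -> : [exists s, pos v s == x] by apply/existsP; exists false; apply/eqP.
    have -> : (pos v true == x) = false.
      by apply/negP => /eqP xt; have [] := posi v v true false vS vS (etrans xt (esym xf)).
    by case: (between _ _ _).
  have [xt|xt] := eqVneq (pos v true) x.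
    have -> : [exists s, pos v s == x] by apply/existsP; exists true; apply/eqP.
    by case: (between _ _ _).
  have -> : [exists s, pos v s == x] = false.
    by apply/negbTE; rewrite negb_exists; apply/forallP; case.
  by [].
move=> u v; rewrite !inE => /orP[uP|uS] /orP[vP|vS] uv.
- by rewrite qe // /interleave !pos'P // /between !ltn_add2l.
- by rewrite cross.
- have sw : interleave pos' u v = interleave pos' v u.
    by apply: between_cross_sym; rewrite eq_sym neq.
  by rewrite sw cross // es.
- rewrite pose // /interleave !pos'S // /between !ltn_add2r !ltn_pmul2l //.
  all: exact: leq_ltn_trans hM.
Qed.

Hypothesis ecactus : cactus e.

(** The picture of a leaf or pendant cycle around an endpoint, placed at [2], of
    the chord that carries it: consecutive intervals overlap, only the first one
    contains [2], and the last one is bent back to contain [2] as well. The bound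
    [3] matters only for a leaf. *)
Definition pendant_position (p : seq V) (u : V) (s : bool) : nat :=
  let i := index u p in
  if i.+1 == size p then (if s then maxn 3 (2 * i).+1 else 0)
  else if s then 2 * i + 4 else (2 * i).+1.

Lemma cactus_positions (S : {set V}) : exists pos, positions S pos.
Proof.
move En : #|S| => n; elim/ltn_ind: n S En => n IH S En.
have [->|S0] := eqVneq S finset.set0.
  by exists (fun _ _ => 0); split => u v; rewrite ?inE // => s t; rewrite inE.
case: (cactus_end es ei (proj2 ecactus) S0) => [[x xS xiso]|[w [p pd]]].
  have [pos hpos] : exists pos, positions (S :\ x) pos.
    by apply: (IH _ _ _ erefl); rewrite -En (cardsD1 x S) xS.
  pose q (_ : V) (s : bool) := if s then 2 else 1.
  exists (fun u s => if u \in [set x] then 3 * 0 + q u s else 3 * pos u s + 0).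
  rewrite -(finset.setD1K xS).
  apply: (positions_insert hpos); rewrite /q //.
  - split=> u v; first by move=> s t /set1P-> /set1P->; case: s; case: t.
    by move=> /set1P-> /set1P->; rewrite eqxx.
  - by move=> u /set1P->; rewrite !inE eqxx.
  - by move=> u [].
  - by move=> u [].
  - move=> u v /set1P-> ; rewrite !inE => /andP[_ vS].
    by rewrite (negbTE (xiso v vS)) andbF.
have [up sp pS wS wp pp pw po] := pd.
have ES : S = [set u in p] :|: (S :\: [set u in p]).
  by apply/setP => u; rewrite !inE; case: (boolP (u \in p)) => //= /pS.
have [pos hpos] : exists pos, positions (S :\: [set u in p]) pos.
  apply: (IH _ _ _ erefl); rewrite -En; apply: proper_card.
  apply/properP; split; first exact: finset.subsetDl.
  by exists (nth w p 0); rewrite ?inE ?pS ?mem_nth.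
pose k := size p; pose q := pendant_position p.
have ip u : u \in [set u in p]%SET -> index u p < k by rewrite inE -index_mem.
exists (fun u s => if u \in [set u in p] then (2 * k + 2) * pos w true + q u s
                   else (2 * k + 2) * pos u s + 2).
rewrite {1}ES; apply: (positions_insert hpos).
- split=> [u v s t uP vP|u v uP vP uv].
    have iu := ip u uP; have iv := ip v vP.
    rewrite /q /pendant_position -/k => E.
    have [Ei ->] : index u p = index v p /\ s = t.
      by move: E; case: s; case: t; case: eqP; case: eqP; rewrite /k in iu iv *; split; lia.
    by rewrite !inE in uP vP; rewrite -(nth_index w uP) Ei nth_index.
  have iu := ip u uP; have iv := ip v vP.
  have iuv : index u p != index v p.
    rewrite !inE in uP vP; apply: contraNneq uv => Ei.
    by rewrite -(nth_index w uP) Ei nth_index.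
  move: (uP) (vP); rewrite !inE => up' vp'.
  rewrite -{1}(nth_index w up') -{1}(nth_index w vp') pp //.
  rewrite /interleave /between /q /pendant_position -/k.
  by case: (_.+1 =P k) => [Eu|Eu]; case: (_.+1 =P k) => [Ev|Ev]; lia.
- by move=> u uP; rewrite inE uP.
- by rewrite addn2 !ltnS muln_gt0 sp.
- move=> u s /ip iu; rewrite /q /pendant_position -/k.
  by case: (_.+1 =P k); case: s; lia.
- move=> u s /ip iu; rewrite /q /pendant_position -/k.
  by case: (_.+1 =P k); case: s; lia.
- move=> u v uP; rewrite finset.in_setD => /andP[vP vS]; have iu := ip u uP.
  move: (uP) (vP); rewrite !inE => up' vp'.
  have -> : between (q u false) (q u true) 2 = (index u p == 0) || ((index u p).+1 == k).
    by rewrite /between /q /pendant_position -/k; case: (_.+1 =P k); lia.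
  have wPS : w \in S :\: [set u in p] by rewrite !inE wp.
  have [vw|vw] := eqVneq v w.
    rewrite vw -pw // nth_index // es.
    by have -> : [exists s, pos w s == pos w true] by apply/existsP; exists true.
  have -> : [exists s, pos v s == pos w true] = false.
    apply/negbTE; rewrite negb_exists; apply/forallP => s; apply/eqP => E.
    have vPS : v \in S :\: [set u in p] by rewrite finset.in_setD vP.
    by have [vw' _] := hpos.1 _ _ _ _ vPS wPS E; rewrite vw' eqxx in vw.
  apply/negP => /(po u v up' vS); rewrite inE (negbTE vw) /=.
  by rewrite (negbTE vp').
Qed.
End Words.

(** * Moves on clique complexes *)

Lemma sum_eqE (A B : eqType) :
  ((forall a b, (@inl A B a == inr b) = false) *
   (forall a b, (@inr A B b == inl a) = false) *
   (forall a a', (@inl A B a == inl a') = (a == a')) *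
   (forall b b', (@inr A B b == inr b') = (b == b')))%type.
Proof. by []. Qed.

Lemma option_eqE (A : eqType) :
  ((forall a b : A, (Some a == Some b) = (a == b)) *
   (forall a : A, (Some a == None) = false) *
   (forall a : A, (None == Some a) = false))%type.
Proof. by []. Qed.

(** A flag complex, given by its one-skeleton on the vertices in [live]; [link]
    stands for its symmetric reflexive version [compat]. The optional base vertex
    is the place where other complexes can be attached. *)
Record cgraph := CGraph {
  vert :> finType; live : {set vert}; link : rel vert; base : option vert }.

Definition compat (G : cgraph) : rel G :=
  fun x y => (x == y) || (link x y && link y x).
Arguments compat : clear implicits.

Definition cliques (G : cgraph) : {set {set G}} :=
  [set A : {set G} | (A \subset live G) && [forall x in A, forall y in A, compat G x y]].

Definition based (G : cgraph) : Prop := forall u, base G = Some u -> u \in live G.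

Lemma compatxx G x : compat G x x. Proof. by rewrite /compat eqxx. Qed.

Lemma compatC G x y : compat G x y = compat G y x.
Proof. by rewrite /compat eq_sym andbC. Qed.

Lemma compat_link G : reflexive (@link G) -> symmetric (@link G) ->
  compat G =2 @link G.
Proof.
move=> r s x y; rewrite /compat (s y x) andbb.
by case: eqP => // ->; rewrite r.
Qed.

Definition unlink (G : cgraph) (x : G) (Z : seq G) : cgraph :=
  CGraph (live G) (fun u v => compat G u v &&
    ~~ ((u == x) && (v \in Z) || (v == x) && (u \in Z))) (base G).

Definition del_vertex (G : cgraph) (y : G) : cgraph :=
  CGraph (live G :\ y) (compat G) (base G).

Lemma compat_unlink (G : cgraph) (x : G) Z u v : compat (unlink x Z) u v =
  (u == v) || compat G u v && ~~ ((u == x) && (v \in Z) || (v == x) && (u \in Z)).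
Proof.
by rewrite {1}/compat /= (@compatC G v u) [(v == x) && _ || _]orbC andbb.
Qed.

Lemma compat_del_vertex (G : cgraph) (y u v : G) : compat (del_vertex y) u v = compat G u v.
Proof.
by rewrite {1}/compat /= (@compatC G v u) andbb; case: eqP => // ->; rewrite compatxx.
Qed.

(** Elementary moves that preserve the homotopy type of the clique complex. In
    [equiv_unlink] every simplex that contains the edge [x]-[y] can be coned off
    with [p], so that these simplices collapse; in [equiv_del] the vertex [y] is
    dominated by [x]. The base vertex is never deleted, so that a move remains a
    move after something has been attached there. *)
Inductive equiv : cgraph -> cgraph -> Prop :=
| equiv_iso (G H : cgraph) (f : G -> H) :
    {in live G &, injective f} -> f @: live G = live H ->
    {in live G &, forall x y, x != y -> compat H (f x) (f y) = compat G x y} ->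
    based G -> base H = omap f (base G) -> equiv G H
| equiv_unlink (G : cgraph) (x y p : G) :
    based G -> y != x -> p != x -> p != y -> p \in live G ->
    compat G p x -> compat G p y ->
    {in live G, forall z, compat G z x -> compat G z y -> compat G z p} ->
    equiv G (unlink x [:: y])
| equiv_del (G : cgraph) (x y : G) :
    based G -> x != y -> x \in live G -> base G != Some y ->
    {in live G, forall z, compat G z y -> compat G z x} ->
    equiv G (del_vertex y)
| equiv_sym G H : equiv G H -> equiv H G
| equiv_trans G H K : equiv G H -> equiv H K -> equiv G K.

Lemma equiv_based G H : equiv G H -> based G /\ based H.
Proof.
elim=> {G H} [G H f _ fS _ b bE|G x y p b _ _ _ _ _ _ _|G x y b _ _ yb _
  |G H _ []|G H K _ [] ? _ _ []] //.
- split=> // u; rewrite bE; case: (base G) (b : forall u, base G = Some u -> u \in live G) => //= v /(_ v erefl) vS [] <-.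
  by rewrite -fS imset_f.
- split=> // u /= E; rewrite in_setD1 (b _ E) andbT.
  by apply: contraNneq yb => <-; rewrite E.
Qed.

Lemma equiv_same (V : finType) (S S' : {set V}) (c c' : rel V) o o' :
  S = S' -> o = o' -> (forall u, o = Some u -> u \in S) ->
  {in S &, forall x y, x != y -> c x y && c y x = c' x y && c' y x} ->
  equiv (CGraph S c o) (CGraph S' c' o').
Proof.
move=> <- <- b h; apply: (@equiv_iso (CGraph S c o) (CGraph S c' o) id) => //=; last by case: (o).
- by rewrite imset_id.
- by move=> x y xS yS xy; rewrite /compat /= (negbTE xy) /= h.
Qed.

Definition forget (G : cgraph) : cgraph := CGraph (live G) (compat G) None.

Lemma compat_forget G x y : compat (forget G) x y = compat G x y.
Proof.
by rewrite {1}/compat /= (@compatC G y x) andbb; case: eqP => // ->; rewrite compatxx.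
Qed.

Lemma equiv_forget_congr G H : equiv G H -> equiv (forget G) (forget H).
Proof.
elim=> {G H} [G H f fi fS fc b bE|G x y p b yx px py pS cx cy h|G x y b xy xS yb h
  |G H _|G H K _ IH1 _]; last 2 first.
- exact: equiv_sym.
- exact: equiv_trans.
- apply: (@equiv_iso _ _ (f : forget G -> forget H)) => // x y xS yS xy.
  by rewrite !compat_forget fc.
- apply: equiv_trans (@equiv_unlink (forget G) x y p _ yx px py pS _ _ _) _.
  + by move=> ?.
  + by rewrite compat_forget.
  + by rewrite compat_forget.
  + by move=> z zS; rewrite !compat_forget; exact: h.
  apply: equiv_same => //= u v _ _ uv.
  by rewrite !compat_unlink !compat_forget (eq_sym v u) (negbTE uv).
- apply: equiv_trans (@equiv_del (forget G) x y _ xy xS _ _) _ => //.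
  + by move=> z zS; rewrite !compat_forget; exact: h.
  exact: equiv_same.
Qed.

Section Wsusp.
Variables G K : cgraph.

(** The wedge of [G] and the suspension of [K], whose poles are the base vertex
    of [G] and the new vertex [inr None]. *)
Definition wsusp_link : rel (G + option K) := fun u v =>
  match u, v with
  | inl c, inl d => compat G c d
  | inl _, inr None | inr None, inl _ => false
  | inl c, inr (Some _) | inr (Some _), inl c => base G == Some c
  | inr (Some k), inr (Some l) => compat K k l
  | _, _ => true
  end.

Definition wsusp : cgraph := @CGraph (G + option K)%type
  [set v | match v with
    | inl c => c \in live G
    | inr (Some k) => k \in live K
    | inr None => true end]
  wsusp_link (omap inl (base G)).

Lemma wsusp_compat : compat wsusp =2 wsusp_link.
Proof.
apply: compat_link => [[c|[k|]]|[c|[k|]] [d|[l|]]] //=; rewrite ?compatxx //.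
  exact: compatC.
exact: compatC.
Qed.

Lemma wsusp_based : based G -> based wsusp.
Proof. by move=> b [c|k] /=; case: (base G) (b : forall u, base G = Some u -> u \in live G) => //= u /(_ u erefl) uS [] <-; rewrite inE. Qed.
End Wsusp.

Lemma wsusp_congr_r G K K' : based G -> equiv K K' -> equiv (wsusp G K) (wsusp G K').
Proof.
move=> bG; elim=> {K K'} [K H f fi fS fc b bE|K x y p b yx px py pS cx cy h
  |K x y b xy xS yb h|? ? _|? ? ? _ IH1 _]; last 2 first.
- exact: equiv_sym.
- exact: equiv_trans.
- pose F (v : wsusp G K) : wsusp G H := match v with
    | inl c => inl c | inr None => inr None | inr (Some k) => inr (Some (f k)) end.
  apply: (@equiv_iso _ _ F).
  + move=> [c|[k|]] [d|[l|]]; rewrite !inE //= => kS lS; first by case=> ->.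
    by move=> [] /(fi k l kS lS) ->.
  + apply/setP => v; apply/imsetP/idP => [[[c|[k|]]] + ->|]; rewrite ?inE //=.
      by move=> kS; rewrite -fS imset_f.
    case: v => [c|[k|]]; rewrite ?inE /=.
    * by move=> cS; exists (inl c); rewrite ?inE.
    * by rewrite -fS => /imsetP[l lS ->]; exists (inr (Some l)); rewrite ?inE.
    * by exists (inr None); rewrite ?inE.
  + move=> [c|[k|]] [d|[l|]]; rewrite !inE !wsusp_compat //= => kS lS.
    by move=> kl; apply: fc => //; apply: contraNneq kl => ->.
  + exact: wsusp_based.
  + by rewrite /=; case: (base G).
- apply: equiv_trans (@equiv_unlink (wsusp G K) (inr (Some x)) (inr (Some y))
     (inr (Some p)) (wsusp_based bG) _ _ _ _ _ _ _) _ => //.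
  + by rewrite inE.
  + by rewrite wsusp_compat.
  + by rewrite wsusp_compat.
  + by move=> [c|[k|]]; rewrite !inE !wsusp_compat //=; exact: h.
  apply: equiv_same => //=; first exact: (wsusp_based bG).
  move=> [c|[k|]] [d|[l|]] _ _ uv; rewrite !wsusp_compat !inE //= ?compat_unlink ?sum_eqE ?option_eqE ?andbF ?andbT //.
  have kl : k != l by apply: contraNneq uv => ->.
  by rewrite (eq_sym l k) (negbTE kl) !inE.
- apply: equiv_trans (@equiv_del (wsusp G K) (inr (Some x)) (inr (Some y)) (wsusp_based bG) _ _ _ _) _ => //.
  + by rewrite inE.
  + by rewrite /=; case: (base G).
  + by move=> [c|[k|]]; rewrite !inE !wsusp_compat //=; exact: h.
  apply: equiv_same => //=.
  + by apply/setP => -[c|[k|]]; rewrite !inE.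
  + by move=> u E; rewrite !inE; case: u E => [c|k]; case: (base G) (bG : forall u, base G = Some u -> u \in live G) => //= u' /(_ u' erefl) uS [] <-.
  move=> [c|[k|]] [d|[l|]] _ _ uv; rewrite !wsusp_compat //= ?compat_del_vertex //.
Qed.

Lemma wsusp_congr_l G G' K : equiv G G' -> equiv (wsusp G K) (wsusp G' K).
Proof.
elim=> {G G'} [G H f fi fS fc b bE|G x y p b yx px py pS cx cy h
  |G x y b xy xS yb h|? ? _|? ? ? _ IH1 _]; last 2 first.
- exact: equiv_sym.
- exact: equiv_trans.
- pose F (v : wsusp G K) : wsusp H K := match v with
    | inl c => inl (f c) | inr k => inr k end.
  have fb c : c \in live G -> (base H == Some (f c)) = (base G == Some c).
    move=> cS; rewrite bE; case: (base G) (b : forall u, base G = Some u -> u \in live G) => //= u /(_ u erefl) uS.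
    by apply/eqP/eqP => [[]|[->]//]; move/(fi _ _ uS cS) ->.
  apply: (@equiv_iso _ _ F).
  + move=> [c|[k|]] [d|[l|]]; rewrite !inE //= => kS lS; last by case=> ->.
    by move=> [] /(fi c d kS lS) ->.
  + apply/setP => v; apply/imsetP/idP => [[[c|[k|]]] + ->|]; rewrite ?inE //=.
      by move=> kS; rewrite -fS imset_f.
    case: v => [c|[k|]]; rewrite ?inE /=.
    * by rewrite -fS => /imsetP[d dS ->]; exists (inl d); rewrite ?inE.
    * by move=> kS; exists (inr (Some k)); rewrite ?inE.
    * by exists (inr None); rewrite ?inE.
  + move=> [c|[k|]] [d|[l|]]; rewrite !inE !wsusp_compat //= => kS lS kl; rewrite ?fb //.
    by apply: fc => //; apply: contraNneq kl => ->.
  + exact: wsusp_based.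
  + by rewrite /= bE; case: (base G).
- apply: equiv_trans (@equiv_unlink (wsusp G K) (inl x) (inl y)
     (inl p) (wsusp_based b) _ _ _ _ _ _ _) _ => //.
  + by rewrite inE.
  + by rewrite wsusp_compat.
  + by rewrite wsusp_compat.
  + move=> [c|[k|]]; rewrite !inE !wsusp_compat //=; first exact: h.
    by move=> _ /eqP -> /eqP[xy]; rewrite xy eqxx in yx.
  apply: equiv_same => //=; first exact: (wsusp_based b).
  move=> [c|[k|]] [d|[l|]] _ _ uv; rewrite !wsusp_compat !inE //= ?compat_unlink ?sum_eqE ?option_eqE ?andbF ?andbT //.
  have cd : c != d by apply: contraNneq uv => ->.
  by rewrite (eq_sym d c) (negbTE cd) !inE.
- apply: equiv_trans (@equiv_del (wsusp G K) (inl x) (inl y) (wsusp_based b) _ _ _ _) _ => //.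
  + by rewrite inE.
  + by rewrite /=; case: (base G) yb.
  + move=> [c|[k|]]; rewrite !inE !wsusp_compat //=; first exact: h.
    by move=> _ yE; rewrite yE in yb.
  apply: equiv_same => //=.
  + by apply/setP => -[c|[k|]]; rewrite !inE.
  + move=> u E; rewrite !inE; case: (base G) (b : forall u, base G = Some u -> u \in live G) yb E => //= u' /(_ u' erefl) uS yb [] <-.
    by rewrite uS andbT; apply: contraNneq yb => -[->].
  move=> [c|[k|]] [d|[l|]] _ _ uv; rewrite !wsusp_compat //= ?compat_del_vertex //.
Qed.

(** One apex [p] serves for a whole set of edges at [x], because removing some of
    them leaves fewer simplices to be coned off. *)
Lemma equiv_unlink_star (G : cgraph) (x p : G) (Z : seq G) :
  based G -> p != x -> p \in live G -> compat G p x -> x \notin Z -> p \notin Z ->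
  {in Z, forall z, compat G p z} ->
  {in Z, forall z, {in live G, forall t,
     compat G t x -> compat G t z -> compat G t p}} ->
  equiv G (unlink x Z).
Proof.
move=> b px pS cpx xZ pZ cpz h; elim: Z xZ pZ cpz h => [|z Z IH] xZ pZ cpz h.
  case: G b x p px pS cpx xZ pZ cpz h => V S c o b x p *.
  apply: equiv_same => //= u v _ _ uv.
  by rewrite !in_nil !andbF /= !andbT /compat /= (negbTE uv) (eq_sym v u) (negbTE uv) /= [c v u && _]andbC andbb.
move: xZ pZ; rewrite !inE !negb_or => /andP[xz xZ] /andP[pz pZ].
have sub a : a \in Z -> a \in z :: Z by rewrite inE orbC => ->.
apply: equiv_trans (IH xZ pZ (fun a aZ => cpz a (sub a aZ)) (fun a aZ => h a (sub a aZ))) _.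
set G1 := unlink x Z.
have cpz' := cpz z (mem_head _ _); have h' := h z (mem_head _ _).
apply: equiv_trans (@equiv_unlink G1 x z p b _ px pz pS _ _ _) _ => //.
- by rewrite eq_sym.
- by rewrite compat_unlink (negbTE px) cpx eqxx (negbTE pZ).
- by rewrite compat_unlink cpz' (negbTE px) (eq_sym z x) (negbTE xz) orbT.
- move=> t tS; rewrite /G1 !compat_unlink => tx tz.
  have [->|tp] := eqVneq t p => //=.
  rewrite (h' t tS) ?(negbTE pZ) ?(negbTE px) ?andbF //.
    by case/orP: tx => [/eqP->|/andP[]]; rewrite ?compatxx.
  by case/orP: tz => [/eqP->|/andP[]]; rewrite ?compatxx.
apply: equiv_same => //= u v _ _ uv.
rewrite !compat_unlink (eq_sym v u) (negbTE uv) /= !inE !(@compatC G v u).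
case: (compat G u v) => //=.
case: (u == x); case: (v == x); case: (u == z); case: (v == z);
  by case: (u \in Z); case: (v \in Z).
Qed.

(** Vertex splitting: the neighbours [Z] of [x] are handed over to a new vertex
    [p], which keeps only [Q] in common with [x]. A copy of [x] that sees [Z]
    and [Q] is dominated by [x]; it is then an apex for cutting [x] from [Z],
    and [q] is an apex for cutting [x] from the copy. *)
Lemma equiv_split (V : finType) (S : {set V}) (c c' : rel V) (o : option V)
    (x p q : V) (Z Q : {set V}) :
  reflexive c -> symmetric c -> reflexive c' -> symmetric c' ->
  (forall u, o = Some u -> u \in S) -> x \in S -> p \notin S ->
  {subset Z :|: Q <= S} -> {in Z, forall z, z \notin Q} -> x \notin Z :|: Q ->
  {in Z :|: Q, forall z, c x z} -> q \in Q -> {in Q, forall t, c q t} ->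
  {in Z, forall z, {in S, forall t, c x t -> c z t -> t \in x |: (Z :|: Q)}} ->
  {in S, forall t, c' p t = (t \in Z :|: Q)} ->
  {in S, forall t, t != x -> c' x t = c x t && (t \notin Z)} ->
  {in S &, forall s t, s != x -> t != x -> c' s t = c s t} ->
  equiv (CGraph S c o) (CGraph (p |: S) c' o).
Proof.
move=> r s r' s' b xS pS ZQS dZQ xZQ cx qQ cq h c'p c'x c'o.
pose c1 u v := if u == p then (v == p) || (v \in x |: (Z :|: Q))
  else if v == p then u \in x |: (Z :|: Q) else c u v.
pose G1 := CGraph (p |: S) c1 o.
have b1 : based G1 by move=> u /b uS; rewrite !inE uS orbT.
have c1E : compat G1 =2 c1.
  apply: compat_link => [u|u v] /=; first by rewrite /c1; case: (u =P p).
  rewrite /c1 /=.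
  by case: (u =P p) => [up|_]; case: (v =P p) => [vp|_] //; rewrite 1?s // up vp.
have xp : x != p by apply: contraNneq pS => <-.
have ZQp t : t \in Z :|: Q -> t != p by move/ZQS => tS; apply: contraNneq pS => <-.
have c1p t : c1 t p = (t == p) || (t \in x |: (Z :|: Q)).
  by rewrite /c1 eqxx; case: (t =P p).
have c1S u v : u \in S -> v \in S -> c1 u v = c u v.
  move=> uS vS; rewrite /c1 ifF; last by apply: contraNF pS => /eqP <-.
  by rewrite ifF //; apply: contraNF pS => /eqP <-.
apply: equiv_trans (_ : equiv G1 _); first apply: equiv_sym.
  apply: equiv_trans (@equiv_del G1 x p b1 xp _ _ _) _.
  - by rewrite !inE xS orbT.
  - by rewrite /=; apply: contra pS => /eqP/b.
  - move=> t tS; rewrite !c1E c1p => /orP[/eqP->|].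
      by rewrite /c1 eqxx !inE eqxx orbT.
    rewrite inE => /orP[/set1P->|tZ]; first by rewrite c1S ?r.
    by rewrite (c1S t x (ZQS _ tZ) xS) s cx.
  apply: equiv_same => //=.
  - by apply/setP => t; rewrite !inE; case: (t =P p) => [->|_] //=; rewrite (negbTE pS).
  - move=> u ou; rewrite in_setD1 b1 // andbT; apply: contraNneq pS => <-; exact: b.
  move=> u v; rewrite !in_setD1 => /andP[up uS] /andP[vp vS] uv.
  by rewrite !c1E /c1 (negbTE up) (negbTE vp).
have qS : q \in S by apply: ZQS; rewrite inE qQ orbT.
have qp : q != p by apply: contraNneq pS => <-.
have qx : q != x by apply: contraNneq xZQ => <-; rewrite inE qQ orbT.
have [xZ xQ] : x \notin Z /\ x \notin Q.
  by move: xZQ; rewrite inE negb_or => /andP[].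
have qZ : q \notin Z by apply: contraL qQ => /dZQ.
have pZ : p \notin Z.
  by apply: contra pS => pZ; apply: ZQS; rewrite inE pZ.
have px : p != x by rewrite eq_sym.
have e2 : equiv G1 (@unlink G1 x (enum Z)).
  apply: (@equiv_unlink_star G1 x p) => //.
  - by rewrite !inE eqxx.
  - by rewrite compatC c1E c1p !inE eqxx orbT.
  - by rewrite mem_enum.
  - by rewrite mem_enum.
  - by move=> z; rewrite mem_enum => zZ; rewrite compatC c1E c1p !inE zZ !orbT.
  - move=> z; rewrite mem_enum => zZ t; rewrite !inE !c1E c1p => /orP[->//|tS].
    have zS : z \in S by rewrite ZQS // inE zZ.
    by rewrite !c1S // ![c t _]s => xt zt; rewrite (h z) ?orbT.
apply: equiv_trans e2 _; set G2 := @unlink G1 x (enum Z).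
have c2E u v : compat G2 u v =
  (u == v) || c1 u v && ~~ ((u == x) && (v \in Z) || (v == x) && (u \in Z)).
  by rewrite compat_unlink c1E !mem_enum.
apply: equiv_trans (@equiv_unlink G2 x p q b1 px qx qp _ _ _ _) _.
- by rewrite !inE qS orbT.
- by rewrite c2E c1S // s cx ?inE ?qQ ?orbT //= (negbTE qx) (negbTE qZ) !andbF !orbT.
- by rewrite c2E c1p !inE qQ !orbT (negbTE qx) (negbTE px) /= orbT.
- move=> t; rewrite /= in_setU1 => /orP[/eqP->|tS].
    by move=> _ _; rewrite (@compatC G2 p q) c2E c1p !inE qQ (negbTE qx) (negbTE px) /= !orbT.
  rewrite !c2E; case: (t =P p) => [tp|_]; first by rewrite tp (negbTE pS) in tS.
  case: (t =P x) => [->|/eqP tx].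
    by move=> _ _; rewrite (c1S x q xS qS) cx ?inE ?qQ ?orbT //= ?(negbTE qZ) ?(negbTE qx) ?andbF ?orbT.
  rewrite eqxx /= c1p !inE (negbTE tx) ?(negbTE px) /=.
  case/andP=> _ tZ; rewrite (negbTE tZ) /= andbT => /orP[/eqP tp|tQ].
    by rewrite tp (negbTE pS) in tS.
  by rewrite c1S // s cq // (negbTE qx) orbT.
apply: equiv_same => //= u v; rewrite !in_setU1 => uS vS uv.
rewrite (@compatC G2 v u) [c' v u]s' [(v == x) && _ || _]orbC !andbb c2E (negbTE uv) /= !inE.
move: uS vS; case: (u =P p) => [up _|_ /= uS].
  rewrite up in uv *; rewrite eq_sym (negbTE uv) /= => vS; rewrite c'p //.
  rewrite /c1 eqxx (eq_sym v p) (negbTE uv) /= (negbTE px) (negbTE pZ) /= andbF andbT.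
  rewrite !inE; case: (v =P x) => [->|_]; first by rewrite (negbTE xZ) (negbTE xQ).
  by rewrite /= !andbT.
case: (v =P p) => [vp _|_ /= vS].
  rewrite vp s' c'p // c1p (negbTE px) (negbTE pZ) andbF /= andbT.
  have -> : (u == p) = false by apply: contraNF pS => /eqP <-.
  rewrite !inE; case: (u =P x) => [->|_]; first by rewrite (negbTE xZ) (negbTE xQ).
  by rewrite /= !andbT.
rewrite c1S // !andbF !andbT; case: (u =P x) => [ux|/eqP ux] /=.
  by subst u; rewrite (negbTE xZ) andbF orbF c'x // eq_sym.
case: (v =P x) => [vx|/eqP vx] /=; first by rewrite vx s' c'x // s.
by rewrite andbT c'o.
Qed.

(** * Suspensions and wedges of spheres *)

Definition pt_graph : cgraph := @CGraph unit finset.setT (fun _ _ => true) (Some tt).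

(** Suspending a wedge at [z] and attaching the result at [u] is the same as
    attaching both suspensions at [u]. The suspension of [E] and [K] shares the
    path from [u] through [z] to the second pole [vb]. Splitting [vb] separates
    the two suspensions at this pole, and splitting [z] leaves them with the
    common vertex [u]. *)
Section Zip.
Variables (C E K : cgraph) (u : C) (z : E).
Hypotheses (bC : base C = Some u) (uC : u \in live C)
  (bE : base E = Some z) (zE : z \in live E).

Local Notation T := ((C + option E) + option (unit + option K))%type.
Local Notation vC c := (inl (inl c) : T).
Local Notation vb := (inl (inr None) : T).
Local Notation vE e := (inl (inr (Some e)) : T).
Local Notation vb' := (inr None : T).
Local Notation vp := (inr (Some (inl tt)) : T).
Local Notation vb2 := (inr (Some (inr None)) : T).
Local Notation vK k := (inr (Some (inr (Some k))) : T).

(** The four kinds of vertices and the two new ones, with [s1] and [s2] telling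
    whether [vb] and [z] have been split, into [vb] and [vb'] and into [z] and
    [vp]. *)
Definition zip_half (s1 s2 : bool) (v w : T) : bool :=
  match v, w with
  | inl (inl c), inl (inl d) => compat C c d
  | inl (inr (Some e)), inl (inr (Some f)) => compat E e f
  | inr (Some (inr (Some k))), inr (Some (inr (Some l))) => compat K k l
  | inl (inl c), inl (inr (Some _)) => u == c
  | inl (inl c), inr (Some (inr _)) => u == c
  | inl (inl c), inr (Some (inl _)) => s2 && (u == c)
  | inl (inr None), inl (inr (Some _)) => true
  | inl (inr None), inr (Some (inr _)) => ~~ s1
  | inr None, inr (Some (inr _)) => s1
  | inr None, inl (inr (Some e)) => [&& s1, ~~ s2 & z == e]
  | inr None, inr (Some (inl _)) => s2
  | inl (inr (Some e)), inr (Some (inr (Some _))) => ~~ s2 && (z == e)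
  | inr (Some (inl _)), inr (Some (inr (Some _))) => s2
  | inr (Some (inr None)), inr (Some (inr (Some _))) => true
  | _, _ => false
  end.
Definition zip_compat s1 s2 (v w : T) := [|| v == w, zip_half s1 s2 v w | zip_half s1 s2 w v].
Local Notation c := zip_compat.

Let cr s1 s2 : reflexive (c s1 s2). Proof. by move=> v; rewrite /zip_compat eqxx. Qed.
Let cs s1 s2 : symmetric (c s1 s2).
Proof. by move=> v w; rewrite /zip_compat eq_sym; congr (_ || _); rewrite orbC. Qed.

Definition zip_live (s1 s2 : bool) : {set T} := [set v | match v with
  | inl (inl c) => c \in live C
  | inl (inr (Some e)) => e \in live E
  | inl (inr None) => true
  | inr None => s1
  | inr (Some (inl _)) => s2
  | inr (Some (inr (Some k))) => k \in live K
  | inr (Some (inr None)) => true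
  end].
Local Notation S := zip_live.
Let o : option T := Some (vC u).

Let oS s1 s2 v : o = Some v -> v \in S s1 s2.
Proof. by case=> <-; rewrite inE. Qed.

Let cE s1 s2 : compat (CGraph (S s1 s2) (c s1 s2) o) =2 c s1 s2.
Proof. exact: (@compat_link (CGraph (S s1 s2) (c s1 s2) o) (cr s1 s2) (cs s1 s2)). Qed.
Ltac same_compat := rewrite ?orbF ?andbT //;
  let h := fresh in move=> _ _ h; rewrite ?(negbTE h) //= 1?compatC ?orbb //;
  try by case: eqP => // ->; rewrite compatxx.
Ltac finish := try done; intros;
  repeat match goal with H : is_true (_ == _) |- _ => move/eqP: H => H; subst end;
  rewrite ?eqxx; try done; try (by rewrite eq_sym);
  try (by apply/esym/negbTE; rewrite eq_sym);
  try (match goal with |- context [compat ?G ?a ?b] =>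
    by rewrite ?(@compatC G b a) ?(eq_sym b a) ?orbb ?andbb; case: eqP => // ->;
       rewrite ?compatxx end);
  try (match goal with H : is_true ?b |- context [?b] => by rewrite H ?andbF ?andbT end).
Ltac cases := move=> [[?|[?|]]|[[[]|[?|]]|]].
Ltac simp := rewrite ?inE /zip_compat /= ?(sum_eqE, option_eqE) /= ?orbF ?andbT ?andbF.

Lemma wsusp_zip : equiv (wsusp C (wsusp E K)) (wsusp (wsusp C E) (wsusp pt_graph K)).
Proof.
pose F (v : wsusp C (wsusp E K)) : T := match v with
  | inl c => vC c | inr None => vb | inr (Some (inl e)) => vE e
  | inr (Some (inr None)) => vb2 | inr (Some (inr (Some k))) => vK k end.
have bC' : based C by move=> ?; rewrite bC => -[<-].
have e0 : equiv (wsusp C (wsusp E K)) (CGraph (S false false) (c false false) o).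
  apply: (@equiv_iso _ (CGraph (S false false) (c false false) o) F).
  { by move=> [a|[[a|[a|]]|]] [b|[[b|[b|]]|]] _ _ //= [->]. }
  { apply/setP => v; apply/imsetP/idP => [[[a|[[a|[a|]]|]] + ->]|] /=; rewrite ?inE //.
    case: v => [[a|[a|]]|[[[]|[a|]]|]]; rewrite ?inE //= => aS;
      [exists (inl a)|exists (inr (Some (inl a)))|exists (inr None)
      |exists (inr (Some (inr (Some a))))|exists (inr (Some (inr None)))]; by rewrite ?inE. }
  { move=> [a|[[a|[a|]]|]] [b|[[b|[b|]]|]]; rewrite ?inE !wsusp_compat cE /= ?wsusp_compat.
    all: rewrite /zip_compat /= ?(sum_eqE, option_eqE) /= ?bC ?bE ?option_eqE; same_compat. }
  { exact: wsusp_based. }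
  { by rewrite /= bC. }
apply: equiv_trans e0 _.
have e1 : equiv (CGraph (S false false) (c false false) o)
                (CGraph (S true false) (c true false) o).
  have -> : S true false = vb' |: S false false.
    by apply/setP => -[[a|[a|]]|[[[]|[a|]]|]]; rewrite !inE.
  pose Z : {set T} := [set v | if v is inr (Some (inr (Some k))) then k \in live K else v == vb2].
  apply: (@equiv_split T _ _ _ o vb vb' (vE z) Z [set vE z]) => //; first exact: oS.
  all: rewrite ?inE //.
  { cases; simp; finish. }
  { cases; simp; finish. }
  { cases; simp; finish. }
  { by move=> v /set1P->; rewrite cr. }
  { cases; simp => // ?; cases; simp; finish. }
  { cases; simp; finish. }
  { cases; simp; finish. }
  { cases; simp; cases; simp; finish. }
apply: equiv_trans e1 _.
have e2 : equiv (CGraph (S true false) (c true false) o)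
                (CGraph (S true true) (c true true) o).
  have -> : S true true = vp |: S true false.
    by apply/setP => -[[a|[a|]]|[[[]|[a|]]|]]; rewrite !inE.
  pose Z : {set T} := [set v | if v is inr (Some (inr (Some k))) then k \in live K else v == vb'].
  apply: (@equiv_split T _ _ _ o (vE z) vp (vC u) Z [set vC u]) => //; first exact: oS.
  all: rewrite ?inE //.
  { cases; simp; finish. }
  { cases; simp; finish. }
  { cases; simp; finish. }
  { by move=> v /set1P->; rewrite cr. }
  { cases; simp => // ?; cases; simp; finish. }
  { cases; simp; finish. }
  { cases; simp; finish. }
  { cases; simp; cases; simp; finish. }
apply: equiv_trans e2 _.
apply: equiv_same => //.
{ by apply/setP => -[[a|[a|]]|[[[]|[a|]]|]]; rewrite !inE /= ?inE. }
{ by rewrite /= bC. }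
{ exact: oS. }
move=> [[a|[a|]]|[[[]|[a|]]|]] [[b|[b|]]|[[[]|[b|]]|]] _ _;
  rewrite /= ?wsusp_compat /= ?bC; simp; finish.
Qed.
End Zip.

Definition has_base (G : cgraph) : Prop :=
  exists2 u, base G = Some u & u \in live G.

Lemma has_base_based G : has_base G -> based G.
Proof. by move=> [u bu uG] v; rewrite bu => -[<-]. Qed.

Lemma wsusp_has_base G K : has_base G -> has_base (wsusp G K).
Proof. by move=> [u bu uG]; exists (inl u); rewrite ?inE //= bu. Qed.

Lemma pt_has_base : has_base pt_graph.
Proof. by exists tt. Qed.

(** A suspended point is a path of length two, which retracts to its end. *)
Lemma wsusp_pt C : has_base C -> equiv (wsusp C pt_graph) C.
Proof.
move=> hb; have bb := @wsusp_based C pt_graph (has_base_based hb).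
case: hb => u bu uC.
pose b : wsusp C pt_graph := inr None; pose p : wsusp C pt_graph := inr (Some tt).
have e1 : equiv (wsusp C pt_graph) (del_vertex b).
  apply: (@equiv_del _ p b bb) => //; first by rewrite /p inE.
    by rewrite /= bu.
  by move=> [d|[[]|]] _; rewrite !wsusp_compat.
have e2 : equiv (del_vertex b) (@del_vertex (del_vertex b) p).
  have [_ b1] := equiv_based e1.
  apply: (@equiv_del _ (inl u : del_vertex b) p b1) => //; first by rewrite !inE.
    by rewrite /= bu.
  move=> [d|[[]|]] /=; rewrite !inE //= !compat_del_vertex !wsusp_compat /= bu.
    by move=> dC /eqP[->]; rewrite compatxx.
  by rewrite eqxx.
apply: equiv_trans e1 (equiv_trans e2 (equiv_sym _)).
apply: (@equiv_iso _ _ (fun d : C => (inl d : @del_vertex (del_vertex b) p))).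
- by move=> d e _ _ [].
- apply/setP => v; apply/imsetP/idP => [[d dC ->]|]; first by rewrite !inE.
  by case: v => [d|[[]|]]; rewrite !inE //= => dC; exists d.
- by move=> d e dC eC de; rewrite !compat_del_vertex wsusp_compat.
- by move=> v; rewrite bu => -[<-].
- by rewrite /= bu.
Qed.

Lemma wsusp_forget C K : based C -> equiv (wsusp C (forget K)) (wsusp C K).
Proof.
move=> bC; apply: equiv_same => //; first exact: wsusp_based.
by move=> [a|[a|]] [b|[b|]] _ _ _ //=; rewrite !compat_forget.
Qed.

(** The boundary of the [n]-dimensional cross-polytope, a sphere of dimension
    [n - 1]. *)
Definition cross (n : nat) : cgraph := @CGraph ('I_n * bool)%type finset.setT
  (fun x y => (x.1 != y.1) || (x.2 == y.2)) None.

Lemma cross_compat n x y : compat (cross n) x y = (x.1 != y.1) || (x.2 == y.2).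
Proof.
apply: (@compat_link (cross n)) => [z|z t] /=; first by rewrite !eqxx.
by rewrite eq_sym [z.2 == _]eq_sym.
Qed.

Lemma wsusp_pt_cross n : equiv (forget (wsusp pt_graph (cross n))) (cross n.+1).
Proof.
pose f (v : forget (wsusp pt_graph (cross n))) : cross n.+1 := match v with
  | inl _ => (ord0, true) | inr None => (ord0, false)
  | inr (Some (i, s)) => (lift ord0 i, s) end.
apply: (@equiv_iso _ _ f) => //.
- move=> [[]|[[i s]|]] [[]|[[j t]|]] _ _ //= [].
  by rewrite !add0n => /val_inj -> ->.
- apply/setP => -[i s]; rewrite inE; apply/imsetP.
  case: (unliftP ord0 i) => [j ->|->]; first by exists (inr (Some (j, s))); rewrite ?inE.
  by case: s; [exists (inl tt)|exists (inr None)]; rewrite ?inE.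
- move=> [[]|[[i s]|]] [[]|[[j t]|]] _ _ vw; rewrite compat_forget wsusp_compat cross_compat //=.
  by rewrite cross_compat /= (inj_eq (@lift_inj _ _)).
Qed.

Lemma wsusp_wsusp_cross C n : based C ->
  equiv (wsusp C (wsusp pt_graph (cross n))) (wsusp C (cross n.+1)).
Proof.
move=> bC; apply: equiv_trans (equiv_sym (wsusp_forget _ bC)) _.
exact: wsusp_congr_r bC (wsusp_pt_cross n).
Qed.

Definition attach_spheres (C : cgraph) (l : seq nat) : cgraph :=
  foldl (fun C n => wsusp C (cross n)) C l.

Lemma attach_has_base C l : has_base C -> has_base (attach_spheres C l).
Proof. by elim: l C => //= n l IH C hb; apply: IH; exact: wsusp_has_base. Qed.

(** By induction on the number of spheres, zipping off the last one: each sphere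
    is suspended and moved to the base vertex of [C]. *)
Lemma wsusp_attach C l : has_base C ->
  equiv (wsusp C (attach_spheres pt_graph l)) (attach_spheres C (map succn l)).
Proof.
move=> hb; elim/last_ind: l => [|l n IH]; first exact: wsusp_pt.
rewrite map_rcons /attach_spheres !foldl_rcons -/(attach_spheres _ _) -/(attach_spheres _ _).
have [z bz zE] := attach_has_base l pt_has_base; have [u bu uC] := hb.
apply: equiv_trans (wsusp_zip _ bu uC bz zE) _.
apply: equiv_trans (wsusp_congr_l _ IH) _.
by apply: wsusp_wsusp_cross; apply/has_base_based/attach_has_base.
Qed.

(** The complex [cross 0] is the empty sphere, which cannot be part of a wedge. *)
Definition sphere_wedge (G : cgraph) : Prop :=
  equiv (forget G) (cross 0) \/
  exists l, equiv (forget G) (forget (attach_spheres pt_graph l)).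

Lemma sphere_wedge_equiv G H : equiv G H -> sphere_wedge G -> sphere_wedge H.
Proof.
move=> /equiv_forget_congr/equiv_sym e [e0|[l e0]]; first by left; exact: equiv_trans e e0.
by right; exists l; exact: equiv_trans e e0.
Qed.

(** The suspension of the empty sphere is a sphere of dimension zero. *)
Lemma wsusp_sphere_wedge C K : has_base C -> sphere_wedge K ->
  exists l, equiv (wsusp C K) (attach_spheres C l).
Proof.
move=> hb; have bC := has_base_based hb => -[e0|[l e0]].
  exists [:: 0]; apply: equiv_trans (equiv_sym (wsusp_forget _ bC)) _.
  exact: wsusp_congr_r.
exists (map succn l); apply: equiv_trans (equiv_sym (wsusp_forget _ bC)) _.
apply: equiv_trans (wsusp_congr_r bC e0) _.
exact: equiv_trans (wsusp_forget _ bC) (wsusp_attach l hb).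
Qed.

Lemma suspension_sphere_wedge K : sphere_wedge K -> sphere_wedge (wsusp pt_graph K).
Proof.
move=> /(wsusp_sphere_wedge pt_has_base)[l e]; right; exists l.
exact: equiv_forget_congr.
Qed.

Lemma suspensions_sphere_wedge A B : sphere_wedge A -> sphere_wedge B ->
  sphere_wedge (wsusp (wsusp pt_graph A) B).
Proof.
move=> /(wsusp_sphere_wedge pt_has_base)[l e].
move=> /(wsusp_sphere_wedge (attach_has_base l pt_has_base))[m e']; right.
exists (l ++ m); apply: equiv_forget_congr.
apply: equiv_trans (wsusp_congr_l B e) _.
by rewrite /attach_spheres foldl_cat.
Qed.

(** * Three cones over nested complexes *)

(** For complexes [B] and [A] with [B] contained in [A], the union of two cones
    over [A] and one cone over [B] is equivalent to the wedge of the suspensions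
    of [A] and [B]: contracting the cone [u * A] to a point leaves the cones
    [v * A] and [w * B] with collapsed bases. Combinatorially, [w * B] is peeled
    off by giving it its own copy of each vertex of [B], one vertex at a time. *)
Section Triangle.
Variables (V : finType) (A B : {set V}) (c : rel V).
Hypotheses (cr : reflexive c) (cs : symmetric c) (BA : {subset B <= A}).

Local Notation T := ((unit + option V) + option V)%type.
Local Notation vu := (inl (inl tt) : T).
Local Notation vv := (inl (inr None) : T).
Local Notation vw := (inr None : T).
Local Notation vA a := (inl (inr (Some a)) : T).
Local Notation vB b := (inr (Some b) : T).

(** The vertices in [D] are still shared by [A] and [B]; the other vertices of
    [B] have been replaced by their copies [vB]. *)
Definition tri_half (D : {set V}) (x y : T) : bool :=
  match x, y with
  | inl (inr (Some a)), inl (inr (Some a')) => c a a'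
  | inl (inr (Some _)), inl _ => true
  | inl (inr (Some a)), inr None => a \in D
  | inl (inr (Some a)), inr (Some b) => (a \in D) && c a b
  | inr (Some _), inl (inl _) => true
  | inr (Some _), inr None => true
  | inr (Some b), inr (Some b') => c b b'
  | _, _ => false
  end.

Definition tri_compat D (x y : T) := [|| x == y, tri_half D x y | tri_half D y x].

Definition tri_live (D : {set V}) : {set T} := [set x | match x with
  | inl (inr (Some a)) => a \in A
  | inr (Some b) => (b \in B) && (b \notin D)
  | _ => true end].

Definition tri D := CGraph (tri_live D) (tri_compat D) None.

Let tri_r D : reflexive (tri_compat D).
Proof. by move=> x; rewrite /tri_compat eqxx. Qed.

Let tri_s D : symmetric (tri_compat D).
Proof. by move=> x y; rewrite /tri_compat eq_sym; congr (_ || _); rewrite orbC. Qed.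

Section Step.
Variables (D : {set V}) (b : V).
Hypotheses (bD : b \in D) (bB : b \in B).
Let bA : b \in A := BA bB.

Ltac finish := rewrite ?in_setD1 ?eqxx ?bD ?(cs _ b) ?(eq_sym _ b) /=;
  repeat (match goal with |- context [b == ?a] => case: (b =P a) => [<-|_] end;
          rewrite ?eqxx);
  rewrite ?eqxx ?bD ?bA ?bB ?cr //=;
  repeat match goal with
  | |- context [in_mem ?x ?X] => case: (in_mem x X)
  | |- context [c ?x ?y] => case: (c x y)
  | |- context [?x == ?y] => case: (x == y) end; try done.
Ltac cases := move=> [[[]|[?|]]|[?|]].
Ltac simp := rewrite ?inE /tri_compat /= ?(sum_eqE, option_eqE) /= ?orbF ?andbT ?andbF ?cr.

(** The copy of [b] takes over [w] and the copies of the neighbours of [b]; it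
    shares with [b] the apex [u] and the neighbours of [b] in [D]. *)
Lemma tri_step : equiv (tri D) (tri (D :\ b)).
Proof.
pose Z : {set T} := [set x | match x with
  | inr None => true
  | inr (Some b') => [&& b' \in B, b' \notin D & c b b']
  | _ => false end].
pose Q : {set T} := [set x | match x with
  | inl (inl _) => true
  | inl (inr (Some a)) => [&& a \in A, a \in D, a != b & c a b]
  | _ => false end].
have E : tri_live (D :\ b) = vB b |: tri_live D.
  apply/setP => -[[[]|[a|]]|[a|]]; rewrite !inE //= ?sum_eqE ?option_eqE.
  by rewrite negb_and negbK; case: eqP => [->|_] //=; rewrite bB.
rewrite /tri E.
apply: (@equiv_split T _ _ _ None (vA b) (vB b) vu Z Q) => //.
all: rewrite ?inE /= ?eqxx ?bD ?andbF //.
{ cases; simp; finish. }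
{ cases; simp; finish. }
{ cases; simp; finish. }
{ cases; simp; finish. }
{ cases; simp => //= ?; cases; simp; finish. }
{ cases; simp; finish. }
{ cases; simp; finish. }
{ cases; simp; cases; simp; finish. }
Qed.
End Step.

Lemma tri_split (D : {set V}) : D \subset B -> equiv (tri D) (tri finset.set0).
Proof.
move En : #|D| => n; elim: n D En => [|n IH] D En DB.
  by move/eqP: En; rewrite cards_eq0 => /eqP ->; apply: equiv_same.
have [b bD] : exists b, b \in D by apply/card_gt0P; rewrite En.
apply: equiv_trans (tri_step bD (fintype.subsetP DB b bD)) (IH _ _ _).
  by move: En; rewrite (cardsD1 b D) bD => -[].
by apply: fintype.subset_trans DB; rewrite finset.subsetDl.
Qed.

Lemma triangle_suspensions u v w :
  uniq [:: u; v; w] -> u \notin A -> v \notin A -> w \notin A ->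
  c u v = false -> c u w = false -> c v w = false ->
  {in A, forall a, c u a} -> {in A, forall a, c v a} ->
  {in A, forall a, c w a = (a \in B)} ->
  equiv (CGraph (u |: (v |: (w |: A))) c None)
    (forget (wsusp (wsusp pt_graph (CGraph A c None)) (CGraph B c None))).
Proof.
rewrite /= !inE negb_or andbT => /andP[/andP[nuv nuw] nvw] uNA vNA wNA cuv cuw cvw cu cv cw.
have cE : compat (CGraph (u |: (v |: (w |: A))) c None) =2 c by apply: compat_link.
pose f (x : V) : T := if x == u then vu else if x == v then vv
  else if x == w then vw else vA x.
have fu : f u = vu by rewrite /f eqxx.
have fv : f v = vv by rewrite /f eqxx eq_sym (negbTE nuv).
have fw : f w = vw by rewrite /f eqxx eq_sym (negbTE nuw) eq_sym (negbTE nvw).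
have fA a : a \in A -> f a = vA a.
  by move=> aA; rewrite /f !ifF //; apply/negbTE; apply: contraTneq aA => ->.
have cvu : c v u = false by rewrite cs.
have cwu : c w u = false by rewrite cs.
have cwv : c w v = false by rewrite cs.
have cuC : {in A, forall a, c a u} by move=> a aA; rewrite cs cu.
have cvC : {in A, forall a, c a v} by move=> a aA; rewrite cs cv.
have cwC : {in A, forall a, c a w = (a \in B)} by move=> a aA; rewrite cs cw.
have e1 : equiv (CGraph (u |: (v |: (w |: A))) c None) (tri B).
  apply: (@equiv_iso (CGraph (u |: (v |: (w |: A))) c None) (tri B) f) => //.
  { move=> x y _ _; rewrite /f.
    repeat (case: eqP => [->|_]) => //; try by move=> [].
    all: repeat (case: eqP => // _). }
  { apply/setP => t; rewrite inE; apply/imsetP/idP => [[x + ->]|].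
      rewrite /f !inE; do 3!case: eqP => //=.
    move=> tS; case: t tS => [[[]|[a|]]|[b|]] tS.
    { by exists u; rewrite ?inE ?eqxx. }
    { by exists a; rewrite ?inE ?tS ?orbT ?fA. }
    { by exists v; rewrite ?inE ?eqxx ?orbT. }
    { by case/andP: tS => -> . }
    { by exists w; rewrite ?inE ?eqxx ?orbT. } }
  move=> x y; rewrite cE (@compat_link (tri B) (tri_r B) (tri_s B)) !inE.
  move=> /or4P[/eqP->|/eqP->|/eqP->|xA] /or4P[/eqP->|/eqP->|/eqP->|yA] xy;
    rewrite ?eqxx // in xy *; rewrite ?fu ?fv ?fw ?fA // /tri_compat /= ?(sum_eqE, option_eqE) /=.
  all: rewrite /tri_compat /= ?(sum_eqE, option_eqE) /= ?orbF.
  all: rewrite ?(cuv, cuw, cvw, cvu, cwu, cwv) //.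
  all: rewrite ?(cu, cv, cw, cuC, cvC, cwC) //.
  by rewrite (cs y x) (negbTE xy) orbb.
apply: equiv_trans e1 (equiv_trans (tri_split (fintype.subxx _)) _).
apply: equiv_same => //.
{ by apply/setP => -[[[]|[a|]]|[b|]]; rewrite !inE //= ?inE ?andbT. }
have cAE : compat (CGraph A c None) =2 c by apply: compat_link.
have cBE : compat (CGraph B c None) =2 c by apply: compat_link.
move=> [[[]|[a|]]|[b|]] [[[]|[a'|]]|[b'|]] _ _ _;
  rewrite /= /tri_compat /= ?(sum_eqE, option_eqE) /= ?inE ?wsusp_compat /= ?cAE ?cBE //.
{ rewrite !wsusp_compat /= !cAE (cs a' a) (eq_sym a' a) !orbb !andbb.
  by case: eqP => // ->; rewrite cr. }
rewrite (cs b' b) (eq_sym b' b) !orbb !andbb.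
by case: eqP => // ->; rewrite cr.
Qed.
End Triangle.

(** * Independence complexes of cacti *)

Lemma sphere_wedge_forget G : sphere_wedge G -> sphere_wedge (forget G).
Proof.
have e : equiv (forget (forget G)) (forget G).
  by apply: equiv_same => // x y _ _ _; rewrite !compat_forget.
move=> [h|[l h]]; [left|right; exists l]; exact: equiv_trans e h.
Qed.

Section Fold.
Variables (V : finType) (c : rel V).
Hypotheses (cr : reflexive c) (cs : symmetric c).

(** Being dominated by [x] survives the deletion of other vertices than [x]. *)
Lemma fold_set (S Y : {set V}) x : x \in S -> x \notin Y ->
  {in Y, forall y, {in S, forall z, c z y -> c z x}} ->
  equiv (CGraph S c None) (CGraph (S :\: Y) c None).
Proof.
move=> xS; move En : #|Y| => n; elim: n Y En => [|n IH] Y En xY h.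
  by move/eqP: En; rewrite cards_eq0 => /eqP->; rewrite finset.setD0; apply: equiv_same.
have [y yY] : exists y, y \in Y by apply/card_gt0P; rewrite En.
have e1 : equiv (CGraph S c None) (CGraph (S :\: (Y :\ y)) c None).
  apply: IH.
  - by move: En; rewrite (cardsD1 y) yY => -[].
  - by rewrite !inE (negbTE xY) andbF.
  - by move=> z; rewrite !inE => /andP[_ zY]; exact: h.
apply: equiv_trans e1 _; set G := CGraph _ c None.
have GE : compat G =2 c by apply: compat_link.
apply: equiv_trans (@equiv_del G x y _ _ _ _ _) _ => //.
- by apply: contraNneq xY => ->.
- by rewrite !inE xS andbT negb_and xY orbT.
- by move=> z; rewrite !inE !GE => /andP[_ zS]; exact: h.
apply: equiv_same => //.
  by apply/setP => z; rewrite !inE; case: eqP => [->|_] /=; rewrite ?yY.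
by move=> u v _ _ _; rewrite !GE.
Qed.

Lemma cone_sphere_wedge (S : {set V}) x : x \in S -> {in S, forall z, c z x} ->
  sphere_wedge (CGraph S c None).
Proof.
move=> xS h; have e1 : equiv (CGraph S c None) (CGraph (S :\: (S :\ x)) c None).
  by apply: (fold_set xS); rewrite ?setD11 // => y _ z zS _; exact: h.
apply: sphere_wedge_equiv (equiv_sym e1) _; right; exists [::] => /=.
apply: equiv_sym; apply: (@equiv_iso (forget pt_graph)
  (forget (CGraph (S :\: (S :\ x)) c None)) (fun _ => x)) => //.
- by move=> [] [].
- apply/setP => z; rewrite !inE; apply/imsetP/idP => [[_ _ ->]|].
    by rewrite eqxx xS.
  by rewrite negb_and negbK => /andP[/orP[/eqP->|/negbTE->//] _]; exists tt.
Qed.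

Lemma edge_suspension (A : {set V}) a b : a != b -> a \notin A -> b \notin A ->
  c a b = false -> {in A, forall z, c a z} -> {in A, forall z, c b z} ->
  equiv (CGraph (a |: (b |: A)) c None)
    (forget (wsusp pt_graph (CGraph A c None))).
Proof.
move=> ab aA bA cab ca cb.
pose f (x : V) : wsusp pt_graph (CGraph A c None) :=
  if x == a then inl tt else if x == b then inr None else inr (Some x).
have fa : f a = inl tt by rewrite /f eqxx.
have fb : f b = inr None by rewrite /f eqxx eq_sym (negbTE ab).
have fA x : x \in A -> f x = inr (Some x).
  by move=> xA; rewrite /f !ifF //; apply/negbTE; apply: contraTneq xA => ->.
have cE S : compat (CGraph S c None) =2 c by apply: compat_link.
have cba : c b a = false by rewrite cs.
have caC : {in A, forall z, c z a} by move=> z zA; rewrite cs ca.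
have cbC : {in A, forall z, c z b} by move=> z zA; rewrite cs cb.
apply: (@equiv_iso (CGraph (a |: (b |: A)) c None)
  (forget (wsusp pt_graph (CGraph A c None))) f) => //.
- move=> x y; rewrite !inE.
  by move=> /or3P[/eqP->|/eqP->|xA] /or3P[/eqP->|/eqP->|yA];
    rewrite ?fa ?fb ?fA // => -[].
- apply/setP => t; rewrite inE; apply/imsetP/idP => [[x + ->]|].
    by rewrite !inE => /or3P[/eqP->|/eqP->|xA]; rewrite ?fa ?fb ?fA.
  case: t => [[]|[x|]] tS.
  + by exists a; rewrite ?inE ?eqxx.
  + by exists x; rewrite ?inE ?tS ?orbT ?fA.
  + by exists b; rewrite ?inE ?eqxx ?orbT.
- move=> x y; rewrite !inE cE compat_forget wsusp_compat.
  move=> /or3P[/eqP->|/eqP->|xA] /or3P[/eqP->|/eqP->|yA] xy;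
    rewrite ?eqxx // in xy *; rewrite ?fa ?fb ?fA //=.
  all: rewrite ?(cab, cba) //.
  all: by rewrite ?(ca, cb, caC, cbC, cE).
Qed.

(** A leaf [a] at [b] dominates all other neighbours of [b]. Once these are gone,
    [a] and [b] are the poles of a suspension. *)
Lemma leaf_sphere_wedge (S : {set V}) a b : a \in S -> b \in S ->
  {in S, forall z, c a z = (z != b)} ->
  sphere_wedge (CGraph [set z in S | c b z && (z != b)] c None) ->
  sphere_wedge (CGraph S c None).
Proof.
move=> aS bS ca; set A := [set z in S | _].
have ab : a != b by rewrite -ca ?cr.
have cab : c a b = false by rewrite ca ?eqxx.
have cba : c b a = false by rewrite cs.
pose Y := [set z in S | (~~ c b z) && (z != a)]%SET.
have e1 : equiv (CGraph S c None) (CGraph (S :\: Y) c None).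
  apply: (fold_set aS); first by rewrite !inE eqxx /= !andbF.
  move=> y; rewrite inE => /and3P[yS cby _] z zS czy.
  by rewrite cs ca //; apply: contraNneq cby => <-.
move=> /suspension_sphere_wedge/sphere_wedge_forget h; apply: sphere_wedge_equiv (equiv_sym e1) _.
have -> : S :\: Y = a |: (b |: A).
  apply/setP => z; rewrite !inE.
  case: (z =P a) => [->|_]; first by rewrite aS !andbF.
  case: (z =P b) => [->|_]; first by rewrite bS cr andbF.
  by rewrite !andbT; case: (z \in S) => //=; rewrite negbK andbT.
apply: sphere_wedge_equiv (equiv_sym (edge_suspension _ _ _ _ _ _)) h => //.
- by rewrite !inE cba andbF.
- by rewrite !inE eqxx !andbF.
- by move=> z; rewrite inE => /and3P[zS _ zb]; rewrite ca.
- by move=> z; rewrite inE => /and3P[].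
Qed.
End Fold.

Section Pendant.
Variable V : finType.

Definition indep_graph (e : rel V) (S : {set V}) : cgraph :=
  CGraph S (fun x y => ~~ e x y) None.

Lemma indep_graph_eq e e' (S : {set V}) : {in S &, e =2 e'} ->
  sphere_wedge (indep_graph e S) -> sphere_wedge (indep_graph e' S).
Proof.
by move=> E; apply: sphere_wedge_equiv; apply: equiv_same => // x y xS yS _; rewrite !E.
Qed.

Definition add_edge (e : rel V) (u v : V) : rel V :=
  fun x y => [|| e x y, (x == u) && (y == v) | (x == v) && (y == u)].

Lemma add_edge_sym e u v : symmetric e -> symmetric (add_edge e u v).
Proof. by move=> es x y; rewrite /add_edge es ![(x == _) && _]andbC [_ && _ || _]orbC. Qed.

Lemma add_edge_irr e u v : irreflexive e -> u != v -> irreflexive (add_edge e u v).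
Proof.
move=> ei uv x; rewrite /add_edge ei /=.
by case: (x =P u) => [->|]; rewrite ?(negbTE uv) ?andbF.
Qed.

(** Removing the closed neighbourhoods of [u] and [v] isolates [p], so that [p]
    is an apex for the independent sets that contain both [u] and [v]; adding
    the edge deletes these sets. *)
Lemma add_edge_equiv (e : rel V) (S : {set V}) u v p :
  symmetric e -> irreflexive e -> u != v -> p != u -> p != v -> p \in S ->
  ~~ e p u -> ~~ e p v -> {in S, forall z, e z p -> e z u || e z v} ->
  equiv (indep_graph e S) (indep_graph (add_edge e u v) S).
Proof.
move=> es ei uv pu pv pS epu epv h.
have cE : compat (indep_graph e S) =2 (fun x y => ~~ e x y).
  by apply: compat_link => [x|x y] /=; rewrite ?ei // es.
apply: equiv_trans (@equiv_unlink (indep_graph e S) u v p _ _ _ _ _ _ _ _) _ => //.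
- by rewrite eq_sym.
- by rewrite cE.
- by rewrite cE.
- move=> z zS; rewrite !cE => zu zv; apply: contra zu => zp.
  by have := h z zS zp; rewrite (negbTE zv) orbF.
apply: equiv_same => //= x y xS yS xy.
rewrite !cE !inE /add_edge (es y x) !negb_or !negb_and.
by case: (e x y); case: (x == u); case: (x == v); case: (y == u); case: (y == v).
Qed.

Lemma pendant_nbr (e : rel V) (S : {set V}) w p i y :
  symmetric e -> pendant e S w p -> i < size p -> y \in S -> e (nth w p i) y ->
  [\/ (y == w) && ((i == 0) || (i.+1 == size p)),
      (0 < i) && (y == nth w p i.-1) | (i.+1 < size p) && (y == nth w p i.+1)].
Proof.
move=> es [up sp pS wS wp pp pw po] ip yS eiy.
have := po _ y (mem_nth w ip) yS eiy; rewrite inE => /orP[/eqP yw|yp].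
  by constructor 1; rewrite yw in eiy *; rewrite eqxx -pw // es.
have jp : index y p < size p by rewrite index_mem.
move: eiy; rewrite -{1}(nth_index w yp) pp // => /orP[/eqP E|/eqP E].
  by constructor 3; rewrite E jp nth_index ?eqxx.
by constructor 2; rewrite -E /= nth_index ?eqxx.
Qed.

(** Three vertices can be taken out of a long pendant cycle by adding and
    removing edges, at the price of one suspension; this ends at a leaf, at a
    triangle, or at a cycle of length four, where opposite neighbours of [w] fold
    onto each other. All complexes that remain are independence complexes on
    vertices away from [p]. *)
Lemma pendant_sphere_wedge (e : rel V) (S : {set V}) w p :
  symmetric e -> irreflexive e -> pendant e S w p ->
  (forall T : {set V}, {subset T <= S} -> {in p, forall x, x \notin T} ->
     sphere_wedge (indep_graph e T)) ->
  sphere_wedge (indep_graph e S).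
Proof.
move En : (size p) => n; elim/ltn_ind: n e S p En => n IH e S p En es ei pd sub.
have cr : reflexive (fun x y => ~~ e x y) by move=> x; rewrite ei.
have cs : symmetric (fun x y => ~~ e x y) by move=> x y; rewrite es.
have [up sp pS wS wp pp pw po] := pd.
have nbr i y := @pendant_nbr e S w p i y es pd.
case: p En up sp pS wp pp pw po sub pd nbr => // a p En up _ pS wp pp pw po sub pd nbr.
have aS : a \in S by apply: pS; rewrite mem_head.
have eaw : e a w by rewrite es (pw 0).
case: p En up pS wp pp pw po sub pd nbr => [|b p] En up pS wp pp pw po sub pd nbr.
  apply: (@leaf_sphere_wedge V _ cr cs S a w) => //.
    move=> z zS; apply/idP/idP => [|zw]; first by apply: contraNneq => ->.
    apply/negP => /(nbr 0 z isT zS)[] //=.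
    by rewrite (negbTE zw).
  apply: sub => z; first by rewrite inE => /andP[].
  by rewrite mem_seq1 => /eqP->; rewrite inE (es w a) eaw andbF.
have eab : e a b by rewrite (pp 0 1).
have bS : b \in S by apply: pS; rewrite !inE eqxx orbT.
have ab : a != b by move: up; rewrite /= inE negb_or => /andP[/andP[]].
have [wa wb] : w != a /\ w != b.
  by move: wp; rewrite !inE !negb_or => /and3P[].
case: p En up pS wp pp pw po sub pd nbr => [|c p] En up pS wp pp pw po sub pd nbr.
  have ebw : e b w by rewrite es (pw 1).
  pose A := S :\: [set a; b; w]; pose B := [set z in A | ~~ e w z]%SET.
  have ES : S = a |: (b |: (w |: A)).
    apply/setP => z; rewrite !inE.
    case: (z =P a) => [->|_] //=; case: (z =P b) => [->|_] //=.
    by case: (z =P w) => [->|_] //=.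
  have AP z : z \in A -> [/\ z \in S, z != a, z != b & z != w].
    by rewrite !inE !negb_or -!andbA => /and4P[].
  have eA : sphere_wedge (indep_graph e A).
    by apply: sub => z; [case/AP|rewrite !inE => /orP[]/eqP->; rewrite eqxx ?orbT].
  have eB : sphere_wedge (indep_graph e B).
    apply: sub => z; first by rewrite inE => /andP[/AP[]].
    by rewrite !inE => /orP[]/eqP->; rewrite eqxx ?orbT.
  rewrite {1}/indep_graph ES.
  apply: sphere_wedge_equiv (equiv_sym (triangle_suspensions (B := B) cr cs _ _ _ _ _ _ _ _ _ _ _)) _.
  { by move=> z; rewrite inE => /andP[]. }
  { by rewrite /= !inE negb_or ab (eq_sym a) wa (eq_sym b) wb. }
  { by rewrite !inE eqxx. }
  { by rewrite !inE eqxx orbT. }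
  { by rewrite !inE eqxx !orbT. }
  { by rewrite eab. }
  { by rewrite eaw. }
  { by rewrite ebw. }
  { move=> z /AP[zS za zb zw]; apply/negP => /(nbr 0 z isT zS)[] //=.
      by rewrite (negbTE zw).
    by rewrite (negbTE zb). }
  { move=> z /AP[zS za zb zw]; apply/negP => /(nbr 1 z isT zS)[] //=.
      by rewrite (negbTE zw).
    by rewrite (negbTE za). }
  { by move=> z zA; rewrite inE zA. }
  apply: sphere_wedge_forget; exact: suspensions_sphere_wedge.
have ebc : e b c by rewrite (pp 1 2).
have cS : c \in S by apply: pS; rewrite !inE eqxx !orbT.
have [ac bc] : a != c /\ b != c.
  by move: up; rewrite /= !inE !negb_or => /andP[/and3P[_ -> _] /andP[/andP[-> _]]].
have wc : w != c by move: wp; rewrite !inE !negb_or => /and4P[].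
case: p En up pS wp pp pw po sub pd nbr => [|d q] En up pS wp pp pw po sub pd nbr.
  (* A pendant cycle of length four: [c] is dominated by [a]. *)
  have ewc : e w c by rewrite (pw 2).
  have e1 : equiv (indep_graph e S) (indep_graph e (S :\: [set c])).
    apply: (fold_set cr cs aS); first by rewrite inE.
    move=> y /set1P-> z zS; apply: contra; rewrite es => /(nbr 0 z isT zS)[] //=.
      by case/andP=> /eqP->.
    by move=> /eqP->.
  apply: sphere_wedge_equiv (equiv_sym e1) _.
  apply: (@leaf_sphere_wedge V _ cr cs _ b a).
  { by rewrite !inE bc. }
  { by rewrite !inE ac. }
  { move=> z; rewrite !inE => /andP[zc zS]; apply/idP/idP => [|za].
      by apply: contraNneq => ->; rewrite es.
    by apply/negP => /(nbr 1 z isT zS)[] //=; rewrite ?andbF ?(negbTE za) ?(negbTE zc). }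
  apply: sub => z; first by rewrite !inE => /andP[/andP[]].
  rewrite !inE => /or3P[]/eqP->; rewrite ?eqxx ?andbF //=.
  by rewrite eab andbF.
(* Adding the edge from [w] to [d], with apex [b], makes the edge from [w] to [a]
   removable, with apex [c]. Then [a] is a leaf at [b], and what remains away from
   [b] is the cycle shortened by [a], [b] and [c]. *)
have ecd : e c d by rewrite (pp 2 3).
have ead : e a d = false by rewrite (pp 0 3).
have ebw : e b w = false by rewrite es (pw 1).
have ecw : e c w = false by rewrite es (pw 2).
have ebd : e b d = false by rewrite (pp 1 3).
have eca : e c a = false by rewrite (pp 2 0).
have [ad bd cd] : [/\ a != d, b != d & c != d].
  by move: up; rewrite /= !inE !negb_or => /and4P[/and4P[_ _ -> _] /and3P[_ -> _] /andP[-> _] _].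
have wd : w != d by move: wp; rewrite !inE !negb_or => /and5P[].
have [aw bw cw dw] : [/\ a != w, b != w, c != w & d != w].
  by rewrite !(eq_sym _ w).
have nb z : z \in S -> e b z -> (z == a) || (z == c).
  by move=> zS /(nbr 1 z isT zS)[] /=; rewrite ?andbF // => ->; rewrite ?orbT.
have nc z : z \in S -> e c z -> (z == b) || (z == d).
  by move=> zS /(nbr 2 z isT zS)[] /=; rewrite ?andbF // => ->; rewrite ?orbT.
have na z : z \in S -> e a z -> (z == w) || (z == b).
  by move=> zS /(nbr 0 z isT zS)[] /=; rewrite ?andbT // => ->; rewrite ?orbT.
pose e1 := add_edge e w d.
have E1 : equiv (indep_graph e S) (indep_graph e1 S).
  apply: (@add_edge_equiv e S w d b) => //; rewrite ?ebw ?ebd // 1?eq_sym //.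
  move=> z zS; rewrite es => /(nb z zS)/orP[]/eqP->; first by rewrite eaw.
  by rewrite ecd orbT.
apply: sphere_wedge_equiv (equiv_sym E1) _.
have e1s : symmetric e1 := add_edge_sym w d es.
have e1i : irreflexive e1 := add_edge_irr ei wd.
pose e2 : rel V := fun x y => e1 x y && ~~ ((x == w) && (y == a) || (x == a) && (y == w)).
have e2s : symmetric e2.
  by move=> x y; rewrite /e2 e1s; congr (_ && ~~ _); rewrite orbC ![(_ == w) && _]andbC.
have e2i : irreflexive e2 by move=> x; rewrite /e2 e1i.
have e2E x y : x != w -> y != w -> e2 x y = e x y.
  by move=> xw yw; rewrite /e2 /e1 /add_edge (negbTE xw) (negbTE yw) !andbF /= !andbT ?orbF.
have E2 : equiv (indep_graph e2 S) (indep_graph (add_edge e2 w a) S).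
  apply: (@add_edge_equiv e2 S w a c) => //; rewrite 1?eq_sym //.
  { by rewrite /e2 /e1 /add_edge ecw (eq_sym c w) (negbTE wc) (negbTE cd). }
  { by rewrite e2E ?eca. }
  move=> z zS; case: (z =P w) => [->|/eqP zw].
    by rewrite e2s /e2 /e1 /add_edge ecw (eq_sym c w) (negbTE wc) (negbTE cd).
  rewrite e2E // es => /(nc z zS)/orP[]/eqP->.
    by rewrite orbC e2E // es eab.
  by rewrite /e2 /e1 /add_edge !eqxx (eq_sym d w) (negbTE wd) (eq_sym d a) (negbTE ad) !orbT.
apply: indep_graph_eq (_ : {in S &, add_edge e2 w a =2 e1}) _.
  move=> x y _ _; rewrite {1}/add_edge /e2.
  case: (boolP ((x == w) && (y == a))) => [/andP[/eqP-> /eqP->]|_].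
    by rewrite orbT /e1 /add_edge (es w a) eaw.
  case: (boolP ((x == a) && (y == w))) => [/andP[/eqP-> /eqP->]|_].
    by rewrite orbT /e1 /add_edge eaw.
  by rewrite /= !orbF andbT.
apply: sphere_wedge_equiv E2 _.
have c2r : reflexive (fun x y => ~~ e2 x y) by move=> x; rewrite e2i.
have c2s : symmetric (fun x y => ~~ e2 x y) by move=> x y; rewrite e2s.
apply: (@leaf_sphere_wedge V _ c2r c2s S a b aS bS).
  move=> z zS; apply/idP/idP => [|zb].
    by apply: contraNneq => ->; rewrite e2E ?eab.
  apply/negP; case: (z =P w) => [->|/eqP zw].
    by rewrite /e2 !eqxx orbT andbF.
  by rewrite e2E // => /(na z zS); rewrite (negbTE zw) (negbTE zb).
set T := [set z in S | _]%SET.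
have TP z : z \in T = [&& z \in S, z != a, z != b & z != c].
  rewrite inE; case: (boolP (z \in S)) => //= zS.
  case: (z =P b) => [->|/eqP zb]; rewrite ?andbF ?andbT //=.
  case: (z =P w) => [->|/eqP zw].
    rewrite /e2 /e1 /add_edge ebw (eq_sym b w) (negbTE wb) (negbTE bd) /=.
    by rewrite wa wc.
  rewrite e2E //; apply/idP/idP => [|/andP[za zc]].
    by move=> h; apply/andP; split; apply: contraNneq h => ->; rewrite ?ebc // es.
  by apply/negP => /(nb z zS); rewrite (negbTE za) (negbTE zc).
apply: (@indep_graph_eq e1 e2 T).
  move=> x y; rewrite !TP => /and4P[_ xa _ _] /and4P[_ ya _ _].
  by rewrite /e2 (negbTE xa) (negbTE ya) !andbF andbT.
have sub3 z : z \in d :: q -> z \in [:: a, b, c, d & q].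
  by rewrite !inE => ->; rewrite !orbT.
have := up; rewrite (cat_uniq [:: a; b; c]) => /and3P[_ /hasPn abcq uq].
have e1w x y : x != w -> y != w -> e1 x y = e x y.
  by move=> xw yw; rewrite /e1 /add_edge (negbTE xw) (negbTE yw) !andbF !orbF.
have pw' x : x \in d :: q -> x != w.
  by move=> xq; apply: contraNneq wp => <-; exact: sub3.
have qT x : x \in d :: q -> x \in T.
  move=> xq; rewrite TP pS ?sub3 //=.
  by have := abcq x xq; rewrite !inE !negb_or.
apply: (IH (size (d :: q)) _ e1 T (d :: q)) => //.
- by rewrite -En /= !ltnS -addn2 leq_addr.
- split => //.
  + by rewrite TP wS wa wb wc.
  + by apply: contra wp; exact: sub3.
  + by move=> i j ip jp; rewrite e1w ?pw' ?mem_nth // (pp i.+3 j.+3).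
  + move=> i ip; have id : (nth w (d :: q) i == d) = (i == 0).
      exact: (@nth_uniq _ w (d :: q) i 0 ip isT uq).
    by rewrite /e1 /add_edge eqxx id (negbTE wd) ?andbF ?orbF /= (pw i.+3 ip) orbC.
  + move=> x y xq; rewrite TP => /and4P[yS ya yb yc].
    case: (y =P w) => [->|/eqP yw]; first by rewrite mem_head.
    rewrite (e1w x y (pw' x xq) yw) => /(po x y (sub3 x xq) yS).
    by rewrite !inE (negbTE ya) (negbTE yb) (negbTE yc).
- move=> T' T'T T'q; apply: (@indep_graph_eq e).
    have dT' : d \notin T' by apply: T'q; rewrite mem_head.
    have nd x : x \in T' -> (x == d) = false.
      by move=> xT; apply: contraNF dT' => /eqP<-.
    by move=> x y xT yT; rewrite /e1 /add_edge !nd // !andbF !orbF.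
  have T'S x : x \in T' -> [&& x \in S, x != a, x != b & x != c].
    by move/T'T; rewrite TP.
  apply: sub => x; first by case/T'S/and4P.
  move=> xp; apply/negP => xT; have /and4P[_ xa xb xc] := T'S x xT.
  move: xp; rewrite !(@in_cons _ _ _ x) (negbTE xa) (negbTE xb) (negbTE xc) /= => xq.
  by have := T'q x xq; rewrite xT.
Qed.
End Pendant.

(** Induction on the vertex set: an isolated vertex is a cone point, and the
    other ends of a cactus are leaves and pendant cycles. *)
Theorem cactus_sphere_wedge (V : finType) (e : rel V) (S : {set V}) :
  symmetric e -> irreflexive e -> cactus e -> sphere_wedge (indep_graph e S).
Proof.
move=> es ei [_ ec]; move En : #|S| => n; elim/ltn_ind: n S En => n IH S En.
have [->|S0] := eqVneq S finset.set0.
  left; apply: equiv_sym.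
  pose f (x : cross 0) : forget (indep_graph e finset.set0) :=
    match x with (i, _) => False_rect V (notF (ltn_ord i)) end.
  apply: (@equiv_iso (cross 0) (forget (indep_graph e finset.set0)) f).
  - by case=> -[].
  - by apply/setP => z; rewrite !inE; apply/imsetP => -[[[]]].
  - by case=> -[].
  - by [].
  - by [].
have cr : reflexive (fun x y => ~~ e x y) by move=> x; rewrite ei.
have cs : symmetric (fun x y => ~~ e x y) by move=> x y; rewrite es.
case: (cactus_end es ei ec S0) => [[x xS xiso]|[w [p pd]]].
  by apply: (cone_sphere_wedge cr cs xS) => z zS; rewrite es xiso.
apply: (pendant_sphere_wedge es ei pd) => T TS Tp.
apply: (IH #|T| _ T erefl); rewrite -En; apply: proper_card.
apply/properP; split; first exact/fintype.subsetP.
case: (p) (pendant_size pd) (pendant_sub pd) Tp => // a q _ sub Tp.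
by exists a; [apply: sub; rewrite mem_head|apply: Tp; rewrite mem_head].
Qed.

Import Order.TTheory GRing.Theory Num.Theory.
Import numFieldNormedType.Exports.
Local Open Scope classical_set_scope.
Local Open Scope ring_scope.

(** * Chords of the circle *)

Section Circle.
Variable R : realType.
Implicit Types a b c d r t : R.

(** The rational parametrization of the circle minus a point. *)
Definition circle_point t : 'rV[R]_2 :=
  \row_i (if i == 0 then (1 - t ^+ 2) / (1 + t ^+ 2) else 2 * t / (1 + t ^+ 2)).

Lemma den_neq0 t : 1 + t ^+ 2 != 0.
Proof. by rewrite lt0r_neq0 // ltr_pwDl ?sqr_ge0. Qed.

Lemma circle_point0 t : circle_point t 0 0 = (1 - t ^+ 2) / (1 + t ^+ 2).
Proof. by rewrite mxE. Qed.

Lemma circle_point1 t : circle_point t 0 1 = 2 * t / (1 + t ^+ 2).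
Proof. by rewrite mxE. Qed.

Lemma circle_point_sphere t : unit_sphere (circle_point t).
Proof.
rewrite /unit_sphere /= big_ord_recl big_ord1 circle_point0.
have -> : lift ord0 ord0 = 1 :> 'I_2 by apply: val_inj.
by rewrite circle_point1; have := den_neq0 t => h; field.
Qed.

Lemma circle_point_inj : injective circle_point.
Proof.
move=> s t E; have E0 := congr1 (fun x : 'rV[R]_2 => x 0 0) E.
have E1 := congr1 (fun x : 'rV[R]_2 => x 0 1) E.
rewrite !circle_point0 in E0; rewrite !circle_point1 in E1.
have hs := den_neq0 s; have ht := den_neq0 t.
have F r : 1 + r ^+ 2 != 0 -> (1 + (1 - r ^+ 2) / (1 + r ^+ 2)) * r = 2 * r / (1 + r ^+ 2).
  by move=> h; field.
have G r : 1 + r ^+ 2 != 0 -> 1 + (1 - r ^+ 2) / (1 + r ^+ 2) != 0.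
  move=> h; have -> : 1 + (1 - r ^+ 2) / (1 + r ^+ 2) = 2 / (1 + r ^+ 2) by field.
  by rewrite mulf_neq0 ?invr_neq0 // pnatr_eq0.
apply: (mulfI (G s hs)); rewrite F // E1 E0 -F //.
Qed.

(** The affine function that vanishes on the line through the points with
    parameters [a] and [b]. *)
Definition chord_form a b (z : 'rV[R]_2) : R :=
  (1 - z 0 0) - (a + b) * z 0 1 + a * b * (1 + z 0 0).

Lemma chord_form_point a b r :
  chord_form a b (circle_point r) = 2 * (r - a) * (r - b) / (1 + r ^+ 2).
Proof.
rewrite /chord_form circle_point0 circle_point1; have := den_neq0 r => h.
by field.
Qed.

Lemma chord_form_segment a b (p q : 'rV[R]_2) t :
  chord_form a b ((1 - t) *: p + t *: q) =
  (1 - t) * chord_form a b p + t * chord_form a b q.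
Proof. by rewrite /chord_form !mxE; ring. Qed.

(** [chord_form a b] changes sign along the chord from [c] to [d] exactly when
    [c] and [d] lie on different sides of the line through [a] and [b]. *)
Lemma chords_meet a b c d :
  c != a -> c != b -> d != a -> d != b ->
  segment (circle_point a) (circle_point b) `&`
    segment (circle_point c) (circle_point d) !=set0 <->
  ((c - a) * (c - b)) * ((d - a) * (d - b)) < 0.
Proof.
move=> ca cb da db.
have [hA hB] := (den_neq0 a, den_neq0 b); have [hC hD] := (den_neq0 c, den_neq0 d).
have pos r : 0 < 1 + r ^+ 2 by rewrite ltr_pwDl ?sqr_ge0.
split.
  move=> [z [[t _ tz] [s s01 sz]]].
  have f0 : chord_form a b z = 0.
    by rewrite -tz chord_form_segment !chord_form_point !subrr !(mulr0, mul0r) addr0.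
  have := f0; rewrite -sz chord_form_segment !chord_form_point.
  move: s01; rewrite /= in_itv /= => /andP[s0 s1] E.
  rewrite ltNge; apply/negP => ge0.
  pose u := (c - a) * (c - b); pose v := (d - a) * (d - b).
  have u0 : u != 0 by rewrite mulf_neq0 ?subr_eq0.
  have v0 : v != 0 by rewrite mulf_neq0 ?subr_eq0.
  have E' : (1 - s) * (1 + d ^+ 2) * u + s * (1 + c ^+ 2) * v = 0.
    have -> : (1 - s) * (1 + d ^+ 2) * u + s * (1 + c ^+ 2) * v =
      ((1 - s) * (2 * (c - a) * (c - b) / (1 + c ^+ 2)) +
       s * (2 * (d - a) * (d - b) / (1 + d ^+ 2))) * (1 + c ^+ 2) * (1 + d ^+ 2) / 2.
      rewrite /u /v; field; by rewrite ?hC ?hD.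
    by rewrite E !mul0r.
  have uv : 0 < u * v by rewrite lt_neqAle eq_sym mulf_neq0.
  have k1 : 0 <= (1 - s) * (1 + d ^+ 2) by rewrite mulr_ge0 ?subr_ge0 // ltW.
  have k2 : 0 <= s * (1 + c ^+ 2) by rewrite mulr_ge0 // ltW.
  have k3 : 0 < (1 - s) * (1 + d ^+ 2) + s * (1 + c ^+ 2).
    have := pos c; have := pos d => pd pc.
    case: (ltrP 0 s) => s'; last by rewrite ltr_wpDr // mulr_gt0 //; lra.
    by rewrite ltr_wpDl // mulr_gt0.
  have : ((1 - s) * (1 + d ^+ 2) * u + s * (1 + c ^+ 2) * v) * u = 0 by rewrite E' mul0r.
  have : ((1 - s) * (1 + d ^+ 2) * u + s * (1 + c ^+ 2) * v) * v = 0 by rewrite E' mul0r.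
  have u2 : 0 < u ^+ 2 by rewrite exprn_even_gt0.
  have v2 : 0 < v ^+ 2 by rewrite exprn_even_gt0.
  move: k1 k2 k3; move: ((1 - s) * _) (s * _) => x y; move: uv u2 v2; clear; nra.
move=> neg.
pose u := (c - a) * (c - b); pose v := (d - a) * (d - b).
pose u' := (a - c) * (a - d); pose v' := (b - c) * (b - d).
have neg1 : u * v < 0 by [].
have neg2 : u' * v' < 0 by rewrite (_ : u' * v' = u * v) // /u /v /u' /v'; ring.
have itv (x y k l : R) : x * y < 0 -> 0 < k -> 0 < l ->
    (k * x - l * y != 0) /\ `[0, 1]%classic (k * x / (k * x - l * y)).
  move=> xy k0 l0; rewrite /= in_itv /=; case: (ltrgtP x 0) => x0.
  - have y0 : 0 < y by rewrite -(nmulr_rlt0 _ x0).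
    have kx : k * x < 0 by rewrite pmulr_rlt0.
    have ly : 0 < l * y by rewrite mulr_gt0.
    have n0 : k * x - l * y < 0 by rewrite subr_lt0 (lt_trans kx).
    split; first by rewrite lt_eqF.
    have -> : k * x / (k * x - l * y) = - (k * x) / - (k * x - l * y).
      by rewrite invrN mulrNN.
    have n0' : 0 < - (k * x - l * y) by rewrite oppr_gt0.
    rewrite divr_ge0 ?oppr_ge0 ?(ltW kx) ?(ltW n0) //= ler_pdivrMr // mul1r.
    by rewrite lerN2 gerDl oppr_le0 ltW.
  - have y0 : y < 0 by rewrite -(pmulr_rlt0 _ x0).
    have kx : 0 < k * x by rewrite mulr_gt0.
    have ly : l * y < 0 by rewrite pmulr_rlt0.
    have n0 : 0 < k * x - l * y by rewrite subr_gt0 (lt_trans ly).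
    split; first by rewrite gt_eqF.
    by rewrite divr_ge0 ?(ltW kx) ?(ltW n0) //= ler_pdivrMr // mul1r lerDl oppr_ge0 ltW.
  - by rewrite x0 mul0r ltxx in xy.
have [n1 i1] := itv _ _ _ _ neg1 (pos d) (pos c).
have [n2 i2] := itv _ _ _ _ neg2 (pos b) (pos a).
(* Each chord is cut where the form of the other one vanishes. *)
exists ((1 - (1 + b ^+ 2) * u' / ((1 + b ^+ 2) * u' - (1 + a ^+ 2) * v')) *: circle_point a +
  ((1 + b ^+ 2) * u' / ((1 + b ^+ 2) * u' - (1 + a ^+ 2) * v')) *: circle_point b).
split; first by exists ((1 + b ^+ 2) * u' / ((1 + b ^+ 2) * u' - (1 + a ^+ 2) * v')).
exists ((1 + d ^+ 2) * u / ((1 + d ^+ 2) * u - (1 + c ^+ 2) * v)) => //.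
rewrite /u /v /u' /v' in n1 n2 *.
apply/rowP => i; rewrite !mxE; case: ifP => _.
  by field; rewrite hA hB hC hD n1 n2.
by field; rewrite hA hB hC hD n1 n2.
Qed.

Lemma mul_lt0_neq (x y : R) : x != 0 -> y != 0 -> (x * y < 0) = ((x < 0) != (y < 0)).
Proof.
move=> x0 y0; case: (ltrgtP x 0) x0 => // hx _; case: (ltrgtP y 0) y0 => // hy _.
- by rewrite ltNge ltW // nmulr_rgt0.
- by rewrite nmulr_rlt0.
- by rewrite pmulr_rlt0.
- by rewrite ltNge ltW // mulr_gt0.
Qed.

Lemma between_sign (a b c : nat) : c != a -> c != b ->
  ((c%:R - a%:R : R) * (c%:R - b%:R) < 0) = between a b c.
Proof.
move=> ca cb; rewrite mul_lt0_neq ?subr_eq0 ?eqr_nat // !subr_lt0 !ltr_nat /between.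
by case: (ltngtP c a) ca => // ? _; case: (ltngtP c b) cb.
Qed.

(** Interleaving only depends on the order of the endpoints, so the positions
    themselves serve as parameters on the circle. *)
Lemma positions_circle_graph (V : finType) (e : rel V) pos :
  irreflexive e -> positions e [set: V]%SET pos -> circle_graph R e.
Proof.
move=> ei [posi pose].
have inj x y i j : pos x i = pos y j -> (x, i) = (y, j).
  by move=> E; have [-> ->] := posi x y i j (finset.in_setT _) (finset.in_setT _) E.
pose endp (p : V * bool) := circle_point (pos p.1 p.2)%:R.
have endp_inj : injective endp.
  by move=> [x i] [y j] /circle_point_inj/eqP; rewrite eqr_nat => /eqP/inj.
exists (ChordDiagram (fun p => circle_point_sphere _) endp_inj) => u v.
case: (eqVneq u v) => [->|uv]; first by rewrite ei; split => // -[].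
have neq i j : pos v i != pos u j.
  by apply/eqP => /inj[vu _]; rewrite vu eqxx in uv.
have key : e u v <-> chord (ChordDiagram (fun p => circle_point_sphere _) endp_inj) u `&`
    chord (ChordDiagram (fun p => circle_point_sphere _) endp_inj) v !=set0.
  rewrite pose ?finset.in_setT // /interleave -!between_sign // -mul_lt0_neq; last 2 first.
  - by rewrite mulf_neq0 // subr_eq0 eqr_nat.
  - by rewrite mulf_neq0 // subr_eq0 eqr_nat.
  rewrite /chord /= /endp /=; apply: iff_sym.
  by apply: chords_meet; rewrite eqr_nat.
by split => [/key h|[_ /key]].
Qed.

Lemma cactus_circle_graph (V : finType) (e : rel V) :
  symmetric e -> irreflexive e -> cactus e -> circle_graph R e.
Proof.
move=> es ei ec; have [pos hpos] := cactus_positions es ei ec [set: V]%SET.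
exact: positions_circle_graph hpos.
Qed.
End Circle.

(** * Homotopies *)

Section ContGen.
Variables X Y Z : topologicalType.
Lemma cont_fst : continuous (@fst X Y).
Proof. by move=> p; exact: cvg_fst. Qed.
Lemma cont_snd : continuous (@snd X Y).
Proof. by move=> p; exact: cvg_snd. Qed.
Lemma cont_pair (f : Z -> X) (g : Z -> Y) :
  continuous f -> continuous g -> continuous (fun z => (f z, g z)).
Proof. by move=> cf cg z; apply: cvg_pair; [exact: cf|exact: cg]. Qed.
Lemma cont_comp (f : Y -> Z) (g : X -> Y) :
  continuous f -> continuous g -> continuous (f \o g).
Proof. by move=> cf cg x; apply: continuous_comp; [exact: cg|exact: cf]. Qed.
End ContGen.

Section Cont.
Variables (R : realType) (X : topologicalType).
Implicit Types f g : X -> R.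
Lemma cont_cst (c : R) : continuous (fun _ : X => c).
Proof. by move=> x; exact: cvg_cst. Qed.
Lemma cont_min f g : continuous f -> continuous g ->
  continuous (fun x => Num.min (f x) (g x)).
Proof. by move=> cf cg x; exact: (@continuous_min R X f g x (cf x) (cg x)). Qed.
Lemma cont_max f g : continuous f -> continuous g ->
  continuous (fun x => Num.max (f x) (g x)).
Proof. by move=> cf cg x; exact: (@continuous_max R X f g x (cf x) (cg x)). Qed.
Lemma cont_add f g : continuous f -> continuous g -> continuous (fun x => f x + g x).
Proof. by move=> cf cg x; exact: (cvgD (cf x) (cg x)). Qed.
Lemma cont_opp f : continuous f -> continuous (fun x => - f x).
Proof. by move=> cf x; exact: (cvgN (cf x)). Qed.
Lemma cont_mul f g : continuous f -> continuous g -> continuous (fun x => f x * g x).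
Proof. by move=> cf cg x; exact: (cvgM (cf x) (cg x)). Qed.
Lemma cont_inv f : continuous f -> (forall x, f x != 0) -> continuous (fun x => (f x)^-1).
Proof. by move=> cf f0 x; exact: (cvgV (f0 x) (cf x)). Qed.
Lemma cont_sum (I : finType) (P : pred I) (F : I -> X -> R) :
  (forall i, P i -> continuous (F i)) -> continuous (fun x => \sum_(i | P i) F i x).
Proof.
move=> cF; have -> : (fun x => \sum_(i | P i) F i x) = \sum_(i | P i) F i.
  by apply/funext => x; rewrite fct_sumE.
move=> x; apply: (big_ind (fun f : X -> R => {for x, continuous f})).
- exact: cvg_cst.
- by move=> f g cf cg; exact: (cvgD cf cg).
- by move=> i Pi; exact: cF.
Qed.
End Cont.

Section Homotopy.
Variable R : realType.

Definition clamp (t : R) : R := Num.max 0 (Num.min 1 t).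

Lemma clamp_itv t : 0 <= clamp t <= 1.
Proof. by rewrite /clamp le_max lexx ge_max ler01 ge_min lexx. Qed.

Lemma clamp_id t : 0 <= t <= 1 -> clamp t = t.
Proof. by move=> /andP[t0 t1]; rewrite /clamp (min_idPr t1) (max_idPr t0). Qed.

Lemma clamp_continuous : continuous clamp.
Proof.
apply: cont_max; first exact: cont_cst.
by apply: cont_min; [exact: cont_cst|move=> t; exact: cvg_id].
Qed.

(** Clamping the time parameter turns a homotopy that is continuous on the
    cylinder only into one that is continuous everywhere. *)
Lemma homotopicP (X Y : topologicalType) (f g : X -> Y) :
  homotopic R f g <-> exists H : X * R -> Y,
    [/\ continuous H, forall x, H (x, 0) = f x & forall x, H (x, 1) = g x].
Proof.
split=> -[H [cH H0 H1]]; last first.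
  by exists H; split => //; apply: continuous_subspaceT.
exists (fun p => H (p.1, clamp p.2)); split => /=; last 2 first.
- by move=> x; rewrite clamp_id ?lexx ?ler01.
- by move=> x; rewrite clamp_id ?lexx ?ler01.
set A := [set: X] `*` `[0, 1] in cH.
have cl p : A (p.1, clamp p.2) by split => //=; rewrite in_itv /=; exact: clamp_itv.
move=> p; apply: (@continuous_comp _ (subspace A) _ (fun p : X * R => (p.1, clamp p.2) : subspace A) H); last exact: cH.
move=> U; case: (nbhs_subspaceP A (p.1, clamp p.2)) => [_|/(_ (cl p))//].
rewrite withinE => -[W nW UW].
have cg : continuous (fun q : X * R => (q.1, clamp q.2)).
  apply: cont_pair; first exact: cont_fst.
  exact: (cont_comp clamp_continuous (@cont_snd _ _)).
have nV : nbhs p [set q | W (q.1, clamp q.2)] := cg p _ nW.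
apply: (@filterS _ (nbhs p) _ _ _ _ nV) => q /= Wq.
have : (W `&` A) (q.1, clamp q.2) := conj Wq (cl q).
by rewrite -UW => -[].
Qed.

Lemma homotopic_refl (X Y : topologicalType) (f : X -> Y) :
  continuous f -> homotopic R f f.
Proof.
move=> cf; apply/homotopicP; exists (f \o fst); split=> //.
exact: (cont_comp cf (@cont_fst _ _)).
Qed.

Lemma homotopic_trans (X Y : topologicalType) (f g h : X -> Y) :
  homotopic R f g -> homotopic R g h -> homotopic R f h.
Proof.
move=> /homotopicP[H [cH H0 H1]] /homotopicP[K [cK K0 K1]].
pose L (p : X * R) := if p.2 <= 2^-1 then H (p.1, clamp (2 * p.2))
                      else K (p.1, clamp (2 * p.2 - 1)).
have half : 0 < (2^-1 : R) by rewrite invr_gt0.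
have cL c : continuous (fun p : X * R => (p.1, clamp (2 * p.2 - c))).
  apply: cont_pair; first exact: cont_fst.
  apply: (cont_comp clamp_continuous); apply: cont_add; last exact: cont_cst.
  by apply: cont_mul; [exact: cont_cst|exact: cont_snd].
apply/homotopicP; exists L; split; last 2 first.
- by move=> x; rewrite /L /= ltW // mulr0 clamp_id ?lexx ?ler01.
- move=> x; rewrite /L /=; have -> : ((1 : R) <= 2^-1) = false.
    by apply/negbTE; rewrite -ltNge invf_lt1 // ltr1n.
  have -> : 2 * 1 - 1 = 1 :> R by ring.
  by rewrite clamp_id ?lexx ?ler01.
pose A := [set p : X * R | p.2 <= 2^-1]; pose B := [set p : X * R | 2^-1 <= p.2].
have clA : closed A.
  have -> : A = snd @^-1` [set t : R | t <= 2^-1] by [].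
  by apply: closed_comp => [p _|]; [exact: cont_snd|exact: closed_le].
have clB : closed B.
  have -> : B = snd @^-1` [set t : R | 2^-1 <= t] by [].
  by apply: closed_comp => [p _|]; [exact: cont_snd|exact: closed_ge].
have wA : {within A, continuous L}.
  apply: (@subspace_eq_continuous _ _ _ (H \o (fun p : X * R => (p.1, clamp (2 * p.2 - 0))))).
    move=> p /set_mem pA; have {}pA : p.2 <= 2^-1 := pA.
    by rewrite /from_subspace /L /= pA subr0.
  by apply: continuous_subspaceT; apply: cont_comp.
have wB : {within B, continuous L}.
  apply: (@subspace_eq_continuous _ _ _ (K \o (fun p : X * R => (p.1, clamp (2 * p.2 - 1))))).
    move=> p /set_mem pB; have {}pB : 2^-1 <= p.2 := pB.
    rewrite /from_subspace /L /=; case: ifP => // pA.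
    have /eqP p2 : p.2 == 2^-1 by rewrite eq_le pA pB.
    have -> : 2 * p.2 = 1 by rewrite p2; field.
    have -> : 1 - 1 = 0 :> R by ring.
    by rewrite !clamp_id ?lexx ?ler01 // K0 H1.
  by apply: continuous_subspaceT; apply: cont_comp.
have := withinU_continuous clA clB wA wB.
have -> : A `|` B = setT.
  by apply/seteqP; split => // p _; case: (leP p.2 2^-1) => hp; [left|right; exact: ltW].
by move=> cLT; apply/continuous_subspace_setT; exact: cLT.
Qed.

Lemma homotopic_compl (X Y Z : topologicalType) (f g : X -> Y) (h : Y -> Z) :
  continuous h -> homotopic R f g -> homotopic R (h \o f) (h \o g).
Proof.
move=> ch /homotopicP[H [cH H0 H1]]; apply/homotopicP; exists (h \o H); split.
- exact: cont_comp.
- by move=> x /=; rewrite H0.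
- by move=> x /=; rewrite H1.
Qed.

Lemma homotopic_compr (X Y Z : topologicalType) (f g : Y -> Z) (h : X -> Y) :
  continuous h -> homotopic R f g -> homotopic R (f \o h) (g \o h).
Proof.
move=> ch /homotopicP[H [cH H0 H1]]; apply/homotopicP.
exists (H \o (fun p : X * R => (h p.1, p.2))); split.
- apply: cont_comp => //; apply: cont_pair; last exact: cont_snd.
  exact: (cont_comp ch (@cont_fst _ _)).
- by move=> x /=; rewrite H0.
- by move=> x /=; rewrite H1.
Qed.

Lemma homotopy_equivalent_sym (X Y : topologicalType) :
  homotopy_equivalent R X Y -> homotopy_equivalent R Y X.
Proof. by move=> [f [g [cf cg h1 h2]]]; exists g, f. Qed.

Lemma homotopy_equivalent_trans (X Y Z : topologicalType) :
  homotopy_equivalent R X Y -> homotopy_equivalent R Y Z ->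
  homotopy_equivalent R X Z.
Proof.
move=> [f [g [cf cg h1 h2]]] [f' [g' [cf' cg' h1' h2']]].
exists (f' \o f), (g \o g'); split; try exact: cont_comp.
- apply: homotopic_trans h1.
  exact: (homotopic_compl cg (homotopic_compr cf h1')).
- apply: homotopic_trans h2'.
  exact: (homotopic_compl cf' (homotopic_compr cg' h2)).
Qed.

Lemma homeo_homotopy_equivalent (X Y : topologicalType) (f : X -> Y) (g : Y -> X) :
  continuous f -> continuous g -> cancel f g -> cancel g f ->
  homotopy_equivalent R X Y.
Proof.
move=> cf cg fK gK; exists f, g; split => //.
  have -> : g \o f = id by apply/funext.
  by apply: homotopic_refl => x; exact: cvg_id.
have -> : f \o g = id by apply/funext.
by apply: homotopic_refl => x; exact: cvg_id.
Qed.

(** A continuous bijection from a compact space to a Hausdorff space is closed. *)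
Lemma compact_bijection_homotopy_equivalent (X Y : topologicalType) (f : X -> Y) :
  compact [set: X] -> hausdorff_space Y -> continuous f -> bijective f ->
  homotopy_equivalent R X Y.
Proof.
move=> cX hY cf [g fK gK]; apply: (homeo_homotopy_equivalent cf _ fK gK).
apply/continuous_closedP => A clA.
have -> : g @^-1` A = f @` A.
  apply/seteqP; split => [y /= gA|y [x Ax <-]]; last by rewrite /= fK.
  by exists (g y).
apply: compact_closed => //; apply: continuous_compact.
  exact: continuous_subspaceT.
by apply: (subclosed_compact clA cX).
Qed.
End Homotopy.

(** * Geometric realizations *)

Section Realization.
Variable R : realType.
Implicit Types V : finType.

Definition barycentric V (K : {set {set V}}) (w : V -> R) : Prop :=
  [/\ forall v, 0 <= w v, \sum_v w v = 1 & [set v | w v != 0]%SET \in K].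

Definition weight V (K : {set {set V}}) (a : geometric_realization R K) : V -> R :=
  \val a.

Definition bary_point V (K : {set {set V}}) (w : V -> R) (h : barycentric K w) :
    geometric_realization R K :=
  exist _ (w : {ptws V -> R}) (mem_set h).

Lemma weightP V (K : {set {set V}}) (a : geometric_realization R K) :
  barycentric K (weight a).
Proof. exact: set_mem (valP a). Qed.

Lemma weight_inj V (K : {set {set V}}) (a b : geometric_realization R K) :
  weight a =1 weight b -> a = b.
Proof. by move=> E; apply: val_inj; apply/funext. Qed.

Lemma weight_continuous V (K : {set {set V}}) (v : V) :
  continuous (fun a : geometric_realization R K => weight a v).
Proof.
have cw : continuous (fun w : {ptws V -> R} => w v).
  exact: (@proj_continuous V (fun _ => R) v).
have ci : continuous (\val : geometric_realization R K -> {ptws V -> R}).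
  exact: initial_continuous.
exact: (cont_comp cw ci).
Qed.

Lemma continuous_weight V (K : {set {set V}}) (X : topologicalType)
    (f : X -> geometric_realization R K) :
  (forall v, continuous (fun x => weight (f x) v)) -> continuous f.
Proof.
move=> cf; apply: continuous_comp_initial => x.
apply/cvg_sup => v; apply: continuous_comp_initial; exact: cf.
Qed.

End Realization.

Section Collapse.
Variables (R : realType) (V : finType) (K : {set {set V}}) (x y p : V).
Hypothesis Kclosed : forall A B : {set V}, A \in K -> B \subset A -> B \in K.
Hypotheses (px : p != x) (py : p != y).
Hypothesis Kapex : forall A, A \in K -> x \in A -> y \in A -> p |: A \in K.

Let K' : {set {set V}} := [set A in K | ~~ ((x \in A) && (y \in A))]%SET.

(** The direction in which mass flows: out of the face [x], [y], into [p]. *)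
Let dir (v : V) : R :=
  (if v == p then (#|[set x; y]%SET|)%:R else 0) - (v \in [set x; y]%SET)%:R.
Let low (w : V -> R) : R := Num.min (w x) (w y).
Let push (w : V -> R) (s : R) (v : V) : R := w v + s * low w * dir v.

Let dir_sum : \sum_v dir v = 0.
Proof.
rewrite big_split /= -big_mkcond big_pred1_eq sumrN -[X in _ - X]natr_sum.
by rewrite -sum1_card -big_mkcond subrr.
Qed.

Let dir_x : dir x = -1.
Proof. by rewrite /dir eq_sym (negbTE px) !inE eqxx sub0r. Qed.

Let dir_y : dir y = -1.
Proof. by rewrite /dir eq_sym (negbTE py) !inE eqxx orbT sub0r. Qed.

Let dir_ge v : v != x -> v != y -> 0 <= dir v.
Proof.
by move=> vx vy; rewrite /dir !inE (negbTE vx) (negbTE vy) subr0; case: ifP.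
Qed.

Let low_ge0 w : barycentric K w -> 0 <= low w.
Proof. by case=> w0 _ _; rewrite /low le_min !w0. Qed.

Let push_bary w s : barycentric K w -> 0 <= s <= 1 -> barycentric K (push w s).
Proof.
move=> bw /andP[s0 s1]; have m0 := low_ge0 bw; case: (bw) => w0 w1 wK; split.
- move=> v; rewrite /push.
  have sm : s * low w <= low w by rewrite ler_piMl.
  have [->|vx] := eqVneq v x.
    rewrite dir_x mulrN1 subr_ge0; apply: le_trans sm _.
    by rewrite /low ge_min lexx.
  have [->|vy] := eqVneq v y.
    rewrite dir_y mulrN1 subr_ge0; apply: le_trans sm _.
    by rewrite /low ge_min lexx orbT.
  by rewrite addr_ge0 // mulr_ge0 ?dir_ge // mulr_ge0.
- by rewrite big_split /= w1 -mulr_sumr dir_sum mulr0 addr0.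
- have [l0|l0] := eqVneq (low w) 0.
    rewrite [X in X \in K](_ : _ = [set v | w v != 0]%SET) //.
    by apply/setP => v; rewrite !inE /push l0 mulr0 mul0r addr0.
  have lp : 0 < low w by rewrite lt_neqAle eq_sym l0.
  have wx : w x != 0.
    by rewrite gt_eqF // (lt_le_trans lp) // /low ge_min lexx.
  have wy : w y != 0.
    by rewrite gt_eqF // (lt_le_trans lp) // /low ge_min lexx orbT.
  apply: (Kclosed (A := p |: [set v | w v != 0]%SET)).
    by apply: Kapex; rewrite // inE.
  apply/fintype.subsetP => v; rewrite !inE; apply: contraNT.
  rewrite negb_or negbK => /andP[vp /eqP wv]; rewrite /push wv add0r /dir (negbTE vp).
  rewrite !inE; case: (v =P x) => [vx|_]; first by rewrite -vx wv eqxx in wx.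
  by case: (v =P y) => [vy|_]; [rewrite -vy wv eqxx in wy|rewrite subrr mulr0].
Qed.

Let push_retract w : barycentric K w -> barycentric K' (push w 1).
Proof.
move=> bw; have [h0 h1 hK] := push_bary bw (s := 1) (ltac:(by rewrite ler01 lexx)).
split=> //; rewrite inE hK /= !inE /push dir_x dir_y mul1r !mulrN1 !subr_eq0.
by rewrite negb_and !negbK /low minEle; case: ifP; rewrite eqxx ?orbT.
Qed.

Let bary_sub (w : V -> R) : barycentric K' w -> barycentric K w.
Proof. by case=> w0 w1; rewrite inE => /andP[wK _]. Qed.

Let push_sub (w : V -> R) s v : barycentric K' w -> push w s v = w v.
Proof.
case=> w0 _; rewrite inE => /andP[_]; rewrite !inE negb_and !negbK => h.
suff -> : push w s v = w v + s * 0 * dir v by rewrite mulr0 mul0r addr0.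
rewrite /push /low; congr (_ + _ * _ * _); apply/eqP; rewrite eq_le le_min !w0 !andbT.
by rewrite ge_min; case/orP: h => /eqP->; rewrite lexx ?orbT.
Qed.

Let low_continuous :
  continuous (fun a : geometric_realization R K => low (weight a)).
Proof. by apply: cont_min; exact: weight_continuous. Qed.

(** Mass is moved from [x] and [y] to [p] at equal speed until one of them is
    exhausted, along a segment inside a simplex since [p] can be added to every
    simplex that contains both. For [x = y] this is the deletion of a dominated
    vertex. *)
Lemma collapse_homotopy_equivalent : homotopy_equivalent R
  (geometric_realization R K) (geometric_realization R K').
Proof.
pose f a : geometric_realization R K' := bary_point (push_retract (weightP a)).
pose g a : geometric_realization R K := bary_point (bary_sub (weightP a)).
have cf : continuous f.
  apply: continuous_weight => v.
  have -> : (fun a => weight (f a) v) =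
    (fun a => weight a v + 1 * low (weight a) * dir v) by [].
  apply: cont_add; first exact: weight_continuous.
  apply: cont_mul; last exact: cont_cst.
  by apply: cont_mul; [exact: cont_cst|exact: low_continuous].
have cg : continuous g by apply: continuous_weight => v; exact: weight_continuous.
exists f, g; split => //; last first.
  have -> : f \o g = id.
    apply/funext => a; apply: weight_inj => v.
    exact: (@push_sub (weight a) 1 v (weightP a)).
  by apply: homotopic_refl => a; exact: cvg_id.
have ct (t : R) : 0 <= 1 - clamp t <= 1.
  by have /andP[h0 h1] := clamp_itv t; rewrite subr_ge0 h1 lerBlDr lerDl h0.
pose H (q : geometric_realization R K * R) : geometric_realization R K :=
  bary_point (push_bary (weightP q.1) (ct q.2)).
apply/homotopicP; exists H; split.
- apply: continuous_weight => v.
  have -> : (fun q => weight (H q) v) = (fun q =>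
      weight q.1 v + (1 - clamp q.2) * low (weight q.1) * dir v) by [].
  have c1 := @cont_fst (geometric_realization R K) R.
  apply: cont_add; first exact: (cont_comp (@weight_continuous R V K v) c1).
  apply: cont_mul; last exact: cont_cst.
  apply: cont_mul; last exact: (cont_comp low_continuous c1).
  apply: cont_add; first exact: cont_cst.
  apply: cont_opp; exact: (cont_comp (@clamp_continuous R) (@cont_snd _ _)).
- move=> a; apply: weight_inj => v.
  by rewrite /H /f /g /weight /= clamp_id ?lexx ?ler01 // subr0.
- move=> a; apply: weight_inj => v.
  rewrite /H /weight /= clamp_id ?lexx ?ler01 // subrr.
  by rewrite /push mul0r mul0r addr0.
Qed.
End Collapse.

Section Maps.
Variable R : realType.

Section Simplicial.
Variables (V V' : finType) (K : {set {set V}}) (K' : {set {set V'}}) (f : V -> V').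
Hypothesis fK : forall A, A \in K -> (f @: A)%SET \in K'.

(** The linear extension of the vertex map [f]. *)
Definition pushforward (w : V -> R) (v' : V') : R := \sum_(v | f v == v') w v.

Lemma pushforward_bary w : barycentric K w -> barycentric K' (pushforward w).
Proof.
case=> w0 w1 wK; split.
- by move=> v'; apply: sumr_ge0.
- rewrite -w1 (partition_big f xpredT) //=.
- suff -> : [set v' | pushforward w v' != 0]%SET = (f @: [set v | w v != 0])%SET.
    exact: fK.
  apply/setP => v'; rewrite inE; apply/idP/imsetP => [|[v + ->]].
    apply: contra_neqP => no; apply: big1 => v /eqP fv; apply/eqP.
    by apply: contra_notT no => wv; exists v; rewrite ?inE.
  rewrite inE => wv; rewrite /pushforward (bigD1 v) //= gt_eqF //.
  by rewrite ltr_wpDr ?sumr_ge0 // lt_neqAle eq_sym wv w0.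
Qed.

Definition simplicial_map (a : geometric_realization R K) :
  geometric_realization R K' := bary_point (pushforward_bary (weightP a)).

Lemma simplicial_map_continuous : continuous simplicial_map.
Proof.
apply: continuous_weight => v'; rewrite /weight /=.
by apply: cont_sum => v _; exact: weight_continuous.
Qed.
End Simplicial.

Lemma cliques_closed (G : cgraph) (A B : {set G}) : A \in cliques G -> B \subset A -> B \in cliques G.
Proof.
rewrite !inE => /andP[AS /forall_inP h] BA; rewrite (fintype.subset_trans BA AS) /=.
apply/forall_inP => x xB; apply/forall_inP => y yB.
by have /forall_inP := h x (fintype.subsetP BA x xB); apply; exact: (fintype.subsetP BA).
Qed.

Lemma weight_live (G : cgraph) (a : geometric_realization R (cliques G)) x :
  x \notin live G -> weight a x = 0.
Proof.
have [_ _] := weightP a; rewrite inE => /andP[/fintype.subsetP sub _].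
by apply: contraNeq => wx; apply: sub; rewrite inE.
Qed.

(** An embedding of [G] as a full subgraph of [H] identifies the realization of
    [G] with the part of the realization of [H] supported on the image. *)
Section Embedding.
Variables (G H : cgraph) (f : G -> H).
Hypotheses (fi : {in live G &, injective f})
  (fS : {in live G, forall x, f x \in live H})
  (fc : {in live G &, forall x y, x != y -> compat H (f x) (f y) = compat G x y}).

Lemma embedding_cliques (A : {set G}) : A \in cliques G -> (f @: A)%SET \in cliques H.
Proof.
rewrite !inE => /andP[AS /forall_inP h]; apply/andP; split.
  by apply/fintype.subsetP => _ /imsetP[x xA ->]; exact: fS (fintype.subsetP AS x xA).
apply/forall_inP => _ /imsetP[x xA ->]; apply/forall_inP => _ /imsetP[y yA ->].
have [->|xy] := eqVneq x y; first exact: compatxx.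
rewrite fc ?(fintype.subsetP AS) //; exact: (forall_inP (h x xA)).
Qed.

Definition pullback (w : H -> R) (x : G) : R := if x \in live G then w (f x) else 0.

Lemma pullback_bary w : barycentric (cliques H) w ->
  (forall y, y \notin (f @: live G)%SET -> w y = 0) ->
  barycentric (cliques G) (pullback w).
Proof.
case=> w0 w1 wK wf; split.
- by move=> x; rewrite /pullback; case: ifP.
- rewrite -w1 /pullback -big_mkcond /= (bigID (mem (f @: live G)%SET)) /=.
  by rewrite [X in _ = _ + X]big1 ?addr0 // big_imset.
- move: wK; rewrite !inE => /andP[_ /forall_inP h]; apply/andP; split.
    by apply/fintype.subsetP => x; rewrite inE /pullback; case: ifP; rewrite ?eqxx.
  apply/forall_inP => x; rewrite inE /pullback; case: ifP => [xS wx|]; rewrite ?eqxx //.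
  apply/forall_inP => y; rewrite inE /pullback; case: ifP => [yS wy|]; rewrite ?eqxx //.
  have [->|xy] := eqVneq x y; first exact: compatxx.
  have /forall_inP := h (f x) (ltac:(by rewrite inE)).
  by move=> /(_ (f y)); rewrite inE fc //; apply.
Qed.

Definition embed := simplicial_map embedding_cliques.

Lemma embed_at a x : x \in live G -> weight (embed a) (f x) = weight a x.
Proof.
move=> xS; rewrite /weight /= /pushforward (bigD1 x) //= big1 ?addr0 //.
move=> y /andP[/eqP fxy yx].
apply: weight_live; apply: contra yx => yS; apply/eqP; exact: fi.
Qed.

Lemma embed_off a y : y \notin (f @: live G)%SET -> weight (embed a) y = 0.
Proof.
move=> yf; rewrite /weight /= /pushforward; apply: big1 => x /eqP fxy.
by apply: weight_live; apply: contra yf => xS; rewrite -fxy imset_f.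
Qed.

Lemma embed_injective : injective embed.
Proof.
move=> a b E; apply: weight_inj => x.
case: (boolP (x \in live G)) => [xS|xS]; last by rewrite !weight_live.
by rewrite -!embed_at // E.
Qed.

Lemma embed_pullback (b : geometric_realization R (cliques H))
    (h : forall y, y \notin (f @: live G)%SET -> weight b y = 0) :
  embed (bary_point (pullback_bary (weightP b) h)) = b.
Proof.
apply: weight_inj => y; case: (boolP (y \in (f @: live G)%SET)) => [/imsetP[x xS ->]|yf].
  by rewrite embed_at // /weight /= /pullback xS.
by rewrite embed_off // h.
Qed.
End Embedding.

Lemma iso_homotopy_equivalent (G H : cgraph) (f : G -> H) :
  {in live G &, injective f} -> (f @: live G)%SET = live H ->
  {in live G &, forall x y, x != y -> compat H (f x) (f y) = compat G x y} ->
  homotopy_equivalent R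
  (geometric_realization R (cliques G)) (geometric_realization R (cliques H)).
Proof.
move=> fi fE fc; have fS : {in live G, forall x, f x \in live H}.
  by move=> x xS; rewrite -fE imset_f.
have off (b : geometric_realization R (cliques H)) y :
    y \notin (f @: live G)%SET -> weight b y = 0.
  by rewrite fE => /weight_live.
pose g b : geometric_realization R (cliques G) :=
  bary_point (pullback_bary fi fc (weightP b) (off b)).
have fK b : embed fS fc (g b) = b by exact: embed_pullback.
apply: (@homeo_homotopy_equivalent R _ _ (embed fS fc) g) => //.
- exact: simplicial_map_continuous.
- apply: continuous_weight => x; rewrite /weight /= /pullback.
  by case: (x \in live G); [exact: weight_continuous|exact: cont_cst].
- by move=> a; apply: (embed_injective fi (fS := fS) (fc := fc)); rewrite fK.
Qed.

Lemma equiv_homotopy_equivalent G H : equiv G H -> homotopy_equivalent R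
  (geometric_realization R (cliques G)) (geometric_realization R (cliques H)).
Proof.
elim=> {G H} [G H f fi fS fc _ _|G x y p _ yx px py pS cx cy h|G x y b xy xS _ h
  |G H _|G H K _ h1 _ h2].
- exact: iso_homotopy_equivalent fi fS fc.
- have := @collapse_homotopy_equivalent R G (cliques G) x y p (@cliques_closed G) px py.
  suff -> : cliques (unlink x [:: y]) =
      [set A in cliques G | ~~ ((x \in A) && (y \in A))]%SET.
    apply => A; rewrite !inE => /andP[AS /forall_inP hA] xA yA.
    have pA z : z \in A -> compat G z p.
      move=> zA; apply: h; first exact: (fintype.subsetP AS).
        exact: (forall_inP (hA z zA)).
      exact: (forall_inP (hA z zA)).
    apply/andP; split; first by rewrite finset.subUset finset.sub1set pS.
    apply/forall_inP => u; rewrite !inE => /orP[/eqP->|uA];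
      apply/forall_inP => v; rewrite !inE => /orP[/eqP->|vA].
    + exact: compatxx.
    + by rewrite compatC pA.
    + exact: pA.
    + exact: (forall_inP (hA u uA)).
  apply/setP => A; rewrite !inE -andbA; congr (_ && _).
  apply/idP/andP => [/forall_inP hA|[/forall_inP hA nA]].
    split.
      apply/forall_inP => u uA; apply/forall_inP => v vA.
      have /forall_inP/(_ v vA) := hA u uA; rewrite compat_unlink.
      by case/orP=> [/eqP->|/andP[]]; rewrite ?compatxx.
    apply/andP => -[xA yA]; have /forall_inP/(_ y yA) := hA x xA.
    by rewrite compat_unlink eq_sym (negbTE yx) !inE !eqxx andbF.
  apply/forall_inP => u uA; apply/forall_inP => v vA.
  rewrite compat_unlink (forall_inP (hA u uA) v vA) /= !inE negb_or.
  apply/orP; right; apply/andP; split; apply: contra nA => /andP[/eqP<- /eqP<-].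
    by rewrite uA vA.
  by rewrite uA vA.
- have xy' : x != y := xy.
  have := @collapse_homotopy_equivalent R G (cliques G) y y x (@cliques_closed G) xy xy.
  suff -> : cliques (del_vertex y) =
      [set A in cliques G | ~~ ((y \in A) && (y \in A))]%SET.
    apply => A; rewrite !inE => /andP[AS /forall_inP hA] yA _.
    have pA z : z \in A -> compat G z x.
      move=> zA; apply: h; first exact: (fintype.subsetP AS).
      exact: (forall_inP (hA z zA)).
    apply/andP; split; first by rewrite finset.subUset finset.sub1set xS.
    apply/forall_inP => u; rewrite !inE => /orP[/eqP->|uA];
      apply/forall_inP => v; rewrite !inE => /orP[/eqP->|vA].
    + exact: compatxx.
    + by rewrite compatC pA.
    + exact: pA.
    + exact: (forall_inP (hA u uA)).
  apply/setP => A; rewrite !inE andbb finset.subsetD1 /= -!andbA; congr (_ && _).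
  rewrite andbC; congr (_ && _).
  by apply: eq_forallb_in => u _; apply: eq_forallb_in => v _; rewrite compat_del_vertex.
- exact: homotopy_equivalent_sym.
- exact: homotopy_equivalent_trans h1 h2.
Qed.
End Maps.

(** * Spheres and wedges *)

Section Models.
Variable R : realType.

Lemma realization_hausdorff (V : finType) (K : {set {set V}}) :
  hausdorff_space (geometric_realization R K).
Proof.
move=> a b clab; apply: weight_inj => v; apply: (@Rhausdorff R).
move=> A B nA nB; have cv := @weight_continuous R V K v.
have [c [Ac Bc]] := clab _ _ (cv a _ nA) (cv b _ nB).
by exists (weight c v).
Qed.

Lemma set_type_compact (T : topologicalType) (A : set T) :
  compact A -> compact [set: set_type A].
Proof.
move=> cA F PF _.
have GA : F (\val @^-1` A) by apply: filterE => x; exact: set_mem (valP x).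
have [p [Ap clp]] := cA (\val @ F) _ GA.
exists (exist _ p (mem_set Ap) : set_type A); split => // U W FU [W' [[W0 oW0 <-] Wp WW]].
have nW0 : nbhs p W0 by apply: open_nbhs_nbhs; split.
have GU : F (\val @^-1` (\val @` U)).
  by apply: (@filterS _ F _ _ _ _ FU) => x Ux; exists x.
have [_ [[z Uz <-] Wz]] := clp _ _ GU nW0.
by exists z; split => //; apply: WW.
Qed.

Definition vertex_weight (V : finType) (x : V) : V -> R := fun v => (v == x)%:R.

Lemma vertex_bary (G : cgraph) (x : G) : x \in live G ->
  barycentric (cliques G) (vertex_weight x).
Proof.
move=> xS; split.
- by move=> v; rewrite /vertex_weight; case: eqP.
- by rewrite (bigD1 x) //= big1 /vertex_weight ?eqxx ?addr0 // => v /negbTE->.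
- rewrite [X in X \in _](_ : _ = [set x]%SET); last first.
    by apply/setP => v; rewrite !inE /vertex_weight pnatr_eq0; case: (v == x).
  rewrite inE finset.sub1set xS /=; apply/forall_inP => u /set1P->.
  by apply/forall_inP => v /set1P->; exact: compatxx.
Qed.

Definition vertex_point (G : cgraph) (x : G) (h : x \in live G) :=
  bary_point (vertex_bary h).

Lemma vertex_pointP (G : cgraph) (x : G) (h : x \in live G)
    (a : geometric_realization R (cliques G)) :
  (forall v, v != x -> weight a v = 0) -> a = vertex_point h.
Proof.
move=> a0; apply: weight_inj => v; rewrite [RHS]/weight /= /vertex_weight.
have [->|vx] := eqVneq v x; last exact: a0.
by have [_ + _] := weightP a; rewrite (bigD1 x) //= big1 ?addr0.
Qed.

(** Every clique lies in one of two full subgraphs that cover the graph, meet in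
    a single vertex and are not adjacent otherwise, so that their realizations
    are the two parts of a wedge. *)
Section Glue.
Variables (G1 G2 D : cgraph) (f1 : G1 -> D) (f2 : G2 -> D) (x1 : G1) (x2 : G2).
Hypotheses (f1i : {in live G1 &, injective f1}) (f2i : {in live G2 &, injective f2})
  (f1S : {in live G1, forall x, f1 x \in live D})
  (f2S : {in live G2, forall x, f2 x \in live D})
  (f1c : {in live G1 &, forall x y, x != y -> compat D (f1 x) (f1 y) = compat G1 x y})
  (f2c : {in live G2 &, forall x y, x != y -> compat D (f2 x) (f2 y) = compat G2 x y})
  (x1S : x1 \in live G1) (x2S : x2 \in live G2) (f12 : f1 x1 = f2 x2)
  (sep : forall x y, x \in live G1 -> y \in live G2 -> x != x1 -> y != x2 ->
     compat D (f1 x) (f2 y) = false)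
  (cover : forall v, v \in live D ->
     (v \in (f1 @: live G1)%SET) || (v \in (f2 @: live G2)%SET)).
Variables (X Y : topologicalType).
Variables (h1 : X -> geometric_realization R (cliques G1))
          (h2 : Y -> geometric_realization R (cliques G2)).
Hypotheses (c1 : continuous h1) (c2 : continuous h2) (b1 : bijective h1) (b2 : bijective h2).

Lemma glue_wedge : exists (x : X) (y : Y)
    (h : wedge2 x y -> geometric_realization R (cliques D)),
  continuous h /\ bijective h.
Proof.
have [g1 h1K g1K] := b1; have [g2 h2K g2K] := b2.
pose x := g1 (vertex_point x1S); pose y := g2 (vertex_point x2S).
exists x, y.
pose e1 := @embed R _ _ _ f1S f1c; pose e2 := @embed R _ _ _ f2S f2c.
pose fam (b : bool) : (if b then X else Y) -> geometric_realization R (cliques D) :=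
  if b return (if b then X else Y) -> geometric_realization R (cliques D)
  then e1 \o h1 else e2 \o h2.
have ce1 : continuous e1 by exact: simplicial_map_continuous.
have ce2 : continuous e2 by exact: simplicial_map_continuous.
have cfam b : continuous (fam b) by case: b; exact: cont_comp.
have not2 z : z \in live G1 -> z != x1 -> f1 z \notin (f2 @: live G2)%SET.
  move=> zS zx; apply/negP => /imsetP[t tS E].
  have [tx|tx] := eqVneq t x2.
    by move: E; rewrite tx -f12 => /(f1i zS x1S) zx1; rewrite zx1 eqxx in zx.
  by have := sep zS tS zx tx; rewrite E compatxx.
have not1 z : z \in live G2 -> z != x2 -> f2 z \notin (f1 @: live G1)%SET.
  move=> zS zx; apply/negP => /imsetP[t tS E].
  have [tx|tx] := eqVneq t x1.
    by move: E; rewrite tx f12 => /(f2i zS x2S) zx1; rewrite zx1 eqxx in zx.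
  by have := sep tS zS tx zx; rewrite -E compatxx.
(* A point in both parts is carried by the common vertex. *)
have mixed a b : e1 a = e2 b -> a = vertex_point x1S /\ b = vertex_point x2S.
  move=> E; split; apply: vertex_pointP => z zx.
    case: (boolP (z \in live G1)) => zS; last exact: weight_live.
    by rewrite -(embed_at f1i f1S f1c a zS) -/e1 E embed_off // not2.
  case: (boolP (z \in live G2)) => zS; last exact: weight_live.
  by rewrite -(embed_at f2i f2S f2c b zS) -/e2 -E embed_off // not1.
have evertex : e1 (vertex_point x1S) = e2 (vertex_point x2S).
  have uS : f1 x1 \in live D by exact: f1S.
  have -> : e1 (vertex_point x1S) = vertex_point uS.
    apply: vertex_pointP => v; case: (boolP (v \in (f1 @: live G1)%SET)).
      move=> /imsetP[z zS ->] zx; rewrite /e1 embed_at // /weight /= /vertex_weight.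
      by case: (z =P x1) zx => // ->; rewrite eqxx.
    by move=> vf _; rewrite /e1 embed_off.
  apply/esym/vertex_pointP => v; rewrite f12; case: (boolP (v \in (f2 @: live G2)%SET)).
    move=> /imsetP[z zS ->] zx; rewrite /e2 embed_at // /weight /= /vertex_weight.
    by case: (z =P x2) zx => // ->; rewrite eqxx.
  by move=> vf _; rewrite /e2 embed_off.
pose p0 (b : bool) : (if b then X else Y) := if b return (if b then X else Y) then x else y.
have famE i j : fam i (p0 i) = fam j (p0 j).
  by case: i; case: j => //=; rewrite /x /y g1K g2K evertex.
pose h : wedge2 x y -> geometric_realization R (cliques D) := wedge_fun fam.
exists h; split; first exact: wedge_fun_continuous.
have hE b (a : if b then X else Y) : h (wedge_lift p0 a) = fam b a.
  exact: wedge_lift_funE.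
have lift_onto (z : wedge2 x y) : exists b (a : if b then X else Y), z = wedge_lift p0 a.
  have : [set: wedge2 x y] z by [].
  by rewrite -wedgeTE => -[b _ [a _ <-]]; exists b, a.
have pE i j : wedge_lift p0 (p0 i) = wedge_lift p0 (p0 j) by exact: wedge_liftE.
have inj_h : injective h.
  move=> z z'; have [b [a ->]] := lift_onto z; have [b' [a' ->]] := lift_onto z'.
  rewrite !hE; case: b a => a; case: b' a' => a' /= E.
  - by congr wedge_lift; apply: (can_inj h1K); apply: (embed_injective f1i E).
  - have [Ea Eb] := mixed _ _ E.
    have -> : a = p0 true by rewrite -[LHS]h1K Ea.
    have -> : a' = p0 false by rewrite -[LHS]h2K Eb.
    exact: (pE true false).
  - have [Ea Eb] := mixed _ _ (esym E).
    have -> : a' = p0 true by rewrite -[LHS]h1K Ea.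
    have -> : a = p0 false by rewrite -[LHS]h2K Eb.
    exact: (pE false true).
  - by congr wedge_lift; apply: (can_inj h2K); apply: (embed_injective f2i E).
have surj_h w : exists z, h z = w.
  have [_ _] := weightP w; rewrite inE => /andP[/fintype.subsetP AS /forall_inP Ac].
  case: (boolP [forall v, (weight w v != 0) ==> (v \in (f1 @: live G1)%SET)]) => [/forallP in1|].
    have off v : v \notin (f1 @: live G1)%SET -> weight w v = 0.
      by move=> vf; apply/eqP; have := in1 v; rewrite (negbTE vf) implybF negbK.
    exists (@wedge_lift bool (fun b => if b then X else Y) p0 true
      (g1 (bary_point (pullback_bary f1i f1c (weightP w) off)))).
    by rewrite hE /= g1K; exact: embed_pullback.
  rewrite negb_forall => /existsP[v]; rewrite negb_imply => /andP[wv vf1].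
  have vA : v \in [set v | weight w v != 0]%SET by rewrite inE.
  have := cover (AS v vA); rewrite (negbTE vf1) /= => /imsetP[t tS vE].
  have tx : t != x2.
    by apply: contraNneq vf1 => tx; rewrite vE tx -f12 imset_f.
  have off v' : v' \notin (f2 @: live G2)%SET -> weight w v' = 0.
    apply: contraNeq => wv'; have v'A : v' \in [set v | weight w v != 0]%SET by rewrite inE.
    have := cover (AS v' v'A) => /orP[/imsetP[s sS v'E]|//].
    have [sx|sx] := eqVneq s x1; first by rewrite v'E sx f12 imset_f.
    have /forall_inP/(_ v vA) := Ac v' v'A.
    by rewrite v'E vE sep.
  exists (@wedge_lift bool (fun b => if b then X else Y) p0 false
    (g2 (bary_point (pullback_bary f2i f2c (weightP w) off)))).
  by rewrite hE /= g2K; exact: embed_pullback.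
exists (fun w => projT1 (cid (surj_h w))) => [z|w].
  by apply: inj_h; case: cid.
by case: cid.
Qed.
End Glue.
End Models.

Section Sphere.
Variables (R : realType) (n : nat).

Definition norm1 (y : 'rV[R]_n) : R := \sum_i `|y 0 i|.

Definition sign_part (s : bool) (t : R) : R := Num.max 0 (if s then t else - t).

(** Radial projection of the round sphere to the unit sphere of the l1 norm,
    whose faces are the simplices of the cross-polytope. *)
Definition radial_weight (y : 'rV[R]_n) (p : cross n) : R :=
  sign_part p.2 (y 0 p.1) / norm1 y.

Lemma sign_part_ge0 s t : 0 <= sign_part s t.
Proof. by rewrite /sign_part le_max lexx. Qed.

Lemma sign_part_sum t : sign_part true t + sign_part false t = `|t|.
Proof.
rewrite /sign_part !maxEle oppr_ge0; case: (ltrgtP 0 t) => [t0|t0|<-].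
- by rewrite addr0 gtr0_norm.
- by rewrite add0r ltr0_norm.
- by rewrite oppr0 addr0 normr0.
Qed.

Lemma sign_part_sub t : sign_part true t - sign_part false t = t.
Proof.
rewrite /sign_part !maxEle oppr_ge0; case: (ltrgtP 0 t) => [t0|t0|<-].
- by rewrite subr0.
- by rewrite sub0r opprK.
- by rewrite oppr0 subr0.
Qed.

Lemma sign_part_mul t : sign_part true t * sign_part false t = 0.
Proof.
rewrite /sign_part !maxEle oppr_ge0; case: (ltrgtP 0 t) => [t0|t0|<-].
- by rewrite mulr0.
- by rewrite mul0r.
- by rewrite mul0r.
Qed.

Lemma sign_part_scale s c t : 0 <= c -> sign_part s (c * t) = c * sign_part s t.
Proof.
move=> c0; rewrite /sign_part; case: s; first by rewrite maxr_pMr // mulr0.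
by rewrite -mulrN maxr_pMr // mulr0.
Qed.

Lemma sign_part_diff (a b : R) s : 0 <= a -> 0 <= b -> a * b = 0 ->
  sign_part s (a - b) = if s then a else b.
Proof.
move=> a0 b0 /eqP; rewrite mulf_eq0 => /orP[]/eqP->; rewrite /sign_part; case: s.
- by rewrite sub0r (max_idPl _) ?oppr_le0.
- by rewrite sub0r opprK (max_idPr _).
- by rewrite subr0 (max_idPr _).
- by rewrite subr0 (max_idPl _) ?oppr_le0.
Qed.

Lemma sum_cross (F : cross n -> R) : \sum_p F p = \sum_i (F (i, true) + F (i, false)).
Proof.
transitivity (\sum_i \sum_b F (i, b)); last by apply: eq_bigr => i _; rewrite big_bool.
by rewrite pair_bigA; apply: eq_bigr => -[].
Qed.

Lemma norm1_gt0 (y : 'rV[R]_n) : unit_sphere y -> 0 < norm1 y.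
Proof.
move=> yS; rewrite lt_neqAle eq_sym sumr_ge0 ?andbT //; apply/eqP => /eqP.
rewrite psumr_eq0 // => /allP y0; have := oner_neq0 R; rewrite -yS big1 ?eqxx // => i _.
by have := y0 i (mem_index_enum _); rewrite normr_eq0 => /eqP->; rewrite expr0n.
Qed.

Lemma radial_bary (y : 'rV[R]_n) : unit_sphere y ->
  barycentric (cliques (cross n)) (radial_weight y).
Proof.
move=> /norm1_gt0 N0; split.
- by move=> p; rewrite divr_ge0 ?sign_part_ge0 // ltW.
- rewrite sum_cross -[RHS](mulfV (lt0r_neq0 N0)) /norm1 mulr_suml.
  by apply: eq_bigr => i _; rewrite /radial_weight /= -mulrDl sign_part_sum.
- rewrite inE finset.subsetT /=; apply/forall_inP => -[i s]; rewrite inE => wi.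
  apply/forall_inP => -[j t]; rewrite inE cross_compat /= => wj.
  have [ij|//] := eqVneq i j; subst j; move: wi wj; rewrite /radial_weight /=.
  have := sign_part_mul (y 0 i); case: s; case: t => //= pm.
    move=> h1 h2; have : sign_part true (y 0 i) / norm1 y * (sign_part false (y 0 i) / norm1 y) != 0.
      by rewrite mulf_neq0.
    by rewrite mulrACA pm mul0r eqxx.
  move=> h1 h2; have : sign_part true (y 0 i) / norm1 y * (sign_part false (y 0 i) / norm1 y) != 0.
    by rewrite mulf_neq0.
  by rewrite mulrACA pm mul0r eqxx.
Qed.

Definition radial (y : set_type (@unit_sphere R n)) :
  geometric_realization R (cliques (cross n)) :=
  bary_point (radial_bary (set_mem (valP y))).

Lemma coord_sphere_continuous i :
  continuous (fun y : set_type (@unit_sphere R n) => (\val y : 'rV[R]_n) 0 i).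
Proof.
have ci : continuous (\val : set_type (@unit_sphere R n) -> 'rV[R]_n).
  exact: initial_continuous.
exact: (@cont_comp _ _ _ (fun y : 'rV[R]_n => y 0 i) _ (@coord_continuous R 1 n 0 i) ci).
Qed.

Lemma radial_continuous : continuous radial.
Proof.
apply: continuous_weight => -[i s]; rewrite /weight /= /radial_weight /=.
apply: cont_mul.
  apply: cont_max; first exact: cont_cst.
  case: s; first exact: coord_sphere_continuous.
  by apply: cont_opp; exact: coord_sphere_continuous.
apply: cont_inv => [|y]; last by rewrite lt0r_neq0 // norm1_gt0 //; exact: set_mem (valP y).
apply: cont_sum => j _ y.
exact: (cvg_norm (@coord_sphere_continuous j y)).
Qed.

Lemma radial_bijective : bijective radial.
Proof.
pose t (w : geometric_realization R (cliques (cross n))) : 'rV[R]_n :=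
  \row_i (weight w (i, true) - weight w (i, false)).
pose q w := Num.sqrt (\sum_i t w 0 i ^+ 2).
have wt w i s : sign_part s (t w 0 i) = weight w (i, s).
  have [w0 _ wK] := weightP w; rewrite mxE sign_part_diff //; first by case: s.
  apply/eqP; rewrite mulf_eq0; apply/orP.
  have [h|h] := eqVneq (weight w (i, true)) 0; first by left.
  have [h'|h'] := eqVneq (weight w (i, false)) 0; first by right.
  move: wK; rewrite inE => /andP[_ /forall_inP hc].
  have /forall_inP := hc (i, true) (ltac:(by rewrite inE)).
  by move=> /(_ (i, false)); rewrite inE cross_compat /= eqxx h' => /(_ isT).
have Nt w : norm1 (t w) = 1.
  have [_ <- _] := weightP w; rewrite sum_cross; apply: eq_bigr => i _.
  by rewrite -sign_part_sum !wt.
have q0 w : 0 < q w.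
  rewrite sqrtr_gt0 lt_neqAle eq_sym sumr_ge0 ?andbT => [|i _]; last exact: sqr_ge0.
  apply/eqP => /eqP; rewrite psumr_eq0 => [|i _]; last exact: sqr_ge0.
  move=> /allP t0; have := oner_neq0 R; rewrite -(Nt w) /norm1 big1 ?eqxx // => i _.
  by have := t0 i (mem_index_enum _); rewrite sqrf_eq0 => /eqP->; rewrite normr0.
have gS w : unit_sphere ((q w)^-1 *: t w).
  rewrite /unit_sphere /=; under eq_bigr do rewrite mxE exprMn.
  rewrite -mulr_sumr -[X in _ * X]sqr_sqrtr; last by apply: sumr_ge0 => i _; exact: sqr_ge0.
  by rewrite -exprMn mulVf ?expr1n // lt0r_neq0.
pose g w : set_type (@unit_sphere R n) := 
  exist (fun x => x \in @unit_sphere R n) _ (mem_set (gS w)).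
exists g => [y|w].
  have yS := set_mem (valP y); have N0 := norm1_gt0 yS.
  have ty : t (radial y) = (norm1 (\val y))^-1 *: \val y.
    apply/rowP => i; rewrite !mxE /weight /= /radial_weight /= -mulrBl sign_part_sub.
    by rewrite mulrC.
  have qy : q (radial y) = (norm1 (\val y))^-1.
    rewrite /q ty; under eq_bigr do rewrite mxE exprMn.
    by rewrite -mulr_sumr yS mulr1 sqrtr_sqr ger0_norm // invr_ge0 ltW.
  apply: val_inj; rewrite /= ty qy scalerA mulVf ?scale1r //.
  by rewrite invr_neq0 // lt0r_neq0.
apply: weight_inj => -[i s]; rewrite [LHS]/weight /= /radial_weight /= mxE.
rewrite sign_part_scale ?wt; last by rewrite invr_ge0 ltW.
have -> : norm1 ((q w)^-1 *: t w) = (q w)^-1.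
  rewrite /norm1; under eq_bigr do rewrite mxE normrM.
  by rewrite -mulr_sumr -/(norm1 _) Nt mulr1 ger0_norm // invr_ge0 ltW.
by rewrite invrK mulrAC mulVf ?mul1r // lt0r_neq0.
Qed.
End Sphere.

Lemma unit_sphere_compact (R : realType) n : compact (@unit_sphere R n).
Proof.
have cI : compact [set v : 'rV[R]_n | forall i, `[-1, 1]%classic (v ord0 i)].
  by apply: (@rV_compact R n (fun=> `[-1, 1]%classic)) => i; exact: segment_compact.
apply: (subclosed_compact _ cI) => [|v vS i].
  have -> : @unit_sphere R n = (fun v : 'rV[R]_n => \sum_i v 0 i ^+ 2) @^-1` [set 1] by [].
  apply: preimage_closed; last exact: closed_eq.
  move=> v _; apply: (@cont_sum R _ _ _ (fun i (v : 'rV[R]_n) => v 0 i ^+ 2)) => i _.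
  by apply: cont_mul; exact: coord_continuous.
have : v 0 i ^+ 2 <= 1.
  by rewrite -vS (bigD1 i) //= lerDl sumr_ge0 // => j _; exact: sqr_ge0.
move=> v1; rewrite /= in_itv /= -ler_norml -(@expr_le1 _ 2) //.
by rewrite -normrX ger0_norm ?sqr_ge0.
Qed.

Section AttachedSpheres.
Variable R : realType.

Lemma wsusp_cross_wedge (C : cgraph) n (X Y : topologicalType)
    (h1 : X -> geometric_realization R (cliques C))
    (h2 : Y -> geometric_realization R (cliques (cross n.+1))) :
  has_base C -> continuous h1 -> continuous h2 -> bijective h1 -> bijective h2 ->
  exists (x : X) (y : Y)
    (h : wedge2 x y -> geometric_realization R (cliques (wsusp C (cross n)))),
  continuous h /\ bijective h.
Proof.
move=> [u bu uC] c1 c2 b1 b2.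
pose f1 (c : C) : wsusp C (cross n) := inl c.
pose f2 (v : cross n.+1) : wsusp C (cross n) :=
  match unlift ord0 v.1 with
  | Some i => inr (Some (i, v.2)) | None => if v.2 then inl u else inr None end.
have f20 s : f2 (ord0, s) = if s then inl u else inr None by rewrite /f2 unlift_none.
have f2S i s : f2 (lift ord0 i, s) = inr (Some (i, s)) by rewrite /f2 liftK.
have cross_ind (P : cross n.+1 -> Prop) : P (ord0, true) -> P (ord0, false) ->
    (forall i s, P (lift ord0 i, s)) -> forall v, P v.
  by move=> h3 h4 h5 [i s]; case: (unliftP ord0 i) => [j ->|->] //; case: s.
have lift0 i : (@lift n.+1 ord0 i == ord0) = false by rewrite eq_sym; apply/negbTE/neq_lift.
have lift0' i : (ord0 == @lift n.+1 ord0 i) = false by apply/negbTE/neq_lift.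
apply: (@glue_wedge R C (cross n.+1) (wsusp C (cross n)) f1 f2 u (ord0, true)
  _ _ _ _ _ _ uC _ _ _ _ X Y h1 h2 c1 c2 b1 b2).
- by move=> x y _ _ [].
- move=> x y _ _; move: x y; apply: (cross_ind); [ | | move=> i s];
    apply: (cross_ind); rewrite ?f20 ?f2S //= => j t; rewrite ?f2S //.
  by case=> -> ->.
- by move=> x xC; rewrite inE.
- by move=> x _; move: x; apply: (cross_ind); rewrite ?f20 ?f2S ?inE // => i s; rewrite f2S inE.
- by move=> x y _ _ _; rewrite wsusp_compat.
{ move=> x y _ _; rewrite wsusp_compat cross_compat; move: x y.
  apply: (cross_ind); [ | | move=> i s]; apply: (cross_ind); rewrite ?f20 ?f2S //=.
  all: rewrite ?eqxx ?compatxx //.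
  all: try (move=> j t; rewrite ?f2S /= ?cross_compat /= ?lift0 ?lift0' ?bu ?eqxx //).
  all: by rewrite ?lift0 ?lift0' ?bu ?eqxx. }
- by rewrite inE.
- by rewrite f20.
- move=> x y xC _ xu; move: y; apply: (cross_ind); rewrite ?f20 ?eqxx ?wsusp_compat //= => i s _.
  rewrite f2S wsusp_compat /= bu; apply/negbTE; apply: contra xu.
  by move=> /eqP[->].
- move=> [c|[[i s]|]]; rewrite inE => vS; apply/orP.
  + by left; apply/imsetP; exists c.
  + by right; apply/imsetP; exists (lift ord0 i, s); rewrite ?inE ?f2S.
  + by right; apply/imsetP; exists (ord0, false); rewrite ?inE ?f20.
Qed.

(** The bijection goes from the wedge to the complex, since maps out of a quotient
    are easy to define; compactness turns it into a homeomorphism. *)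
Lemma attached_spheres_wedge (l : seq nat) : exists W : topologicalType,
  [/\ wedge_of_spheres R W, compact [set: W] &
   exists h : W -> geometric_realization R (cliques (attach_spheres pt_graph l)),
     continuous h /\ bijective h].
Proof.
elim/last_ind: l => [|l n [W [WW cW [h [ch bh]]]]].
  have tS : tt \in live pt_graph by rewrite inE.
  exists (set_type [set (0 : R)]); split; first exact: wedge_point.
    by apply: set_type_compact; exact: compact_set1.
  exists (fun _ => vertex_point R tS); split; first exact: cst_continuous.
  exists (fun _ => exist (fun x => x \in [set (0 : R)]) 0 (mem_set erefl)) => [x|a].
    have x0 : \val x = 0 := set_mem (valP x).
    by apply: val_inj; rewrite x0.
  by apply/esym/vertex_pointP => -[] /eqP.
rewrite /attach_spheres foldl_rcons -/(attach_spheres pt_graph l).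
have [x [y [k [ck bk]]]] := @wsusp_cross_wedge _ n _ _ h (@radial R n.+1)
  (attach_has_base l pt_has_base) ch (@radial_continuous R n.+1) bh (@radial_bijective R n.+1).
exists (wedge2 x y); split; last by exists k.
  by apply: wedge_join => //; exact: wedge_sphere.
apply: wedge_compact; first exact: finite_finset.
by case=> //; apply: set_type_compact; exact: unit_sphere_compact.
Qed.

Lemma attached_spheres_homotopy (l : seq nat) : exists W : topologicalType,
  wedge_of_spheres R W /\ homotopy_equivalent R
    (geometric_realization R (cliques (attach_spheres pt_graph l))) W.
Proof.
have [W [WW cW [h [ch bh]]]] := attached_spheres_wedge l.
exists W; split => //; apply: homotopy_equivalent_sym.
apply: (@compact_bijection_homotopy_equivalent R _ _ h cW _ ch bh).
exact: realization_hausdorff.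
Qed.

Lemma cross0_homotopy : homotopy_equivalent R
  (geometric_realization R (cliques (cross 0))) (set_type (@unit_sphere R 0)).
Proof.
apply: homotopy_equivalent_sym.
apply: (@compact_bijection_homotopy_equivalent R _ _ (@radial R 0) _ _ (@radial_continuous R 0) (@radial_bijective R 0)).
  by apply: set_type_compact; exact: unit_sphere_compact.
exact: realization_hausdorff.
Qed.

Lemma cliques_forget (G : cgraph) : cliques (forget G) = cliques G.
Proof.
apply/setP => A; rewrite !inE /=; congr (_ && _).
by apply: eq_forallb_in => x _; apply: eq_forallb_in => y _; exact: compat_forget.
Qed.

Lemma sphere_wedge_homotopy (G : cgraph) : sphere_wedge G ->
  exists W : topologicalType, wedge_of_spheres R W /\ homotopy_equivalent R
    (geometric_realization R (cliques G)) W.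
Proof.
case=> [/(equiv_homotopy_equivalent R)|[l /(equiv_homotopy_equivalent R)]];
  rewrite !cliques_forget => h.
  exists (set_type (@unit_sphere R 0)); split; first exact: wedge_sphere.
  exact: homotopy_equivalent_trans h cross0_homotopy.
have [W [WW hW]] := attached_spheres_homotopy l.
by exists W; split => //; exact: homotopy_equivalent_trans h hW.
Qed.

Theorem cactus_independence_complex (V : finType) (e : rel V) :
  symmetric e -> irreflexive e -> cactus e ->
  exists W : topologicalType, wedge_of_spheres R W /\
    homotopy_equivalent R
      (geometric_realization R (independence_complex e)) W.
Proof.
move=> es ei ec; have := @sphere_wedge_homotopy _ (cactus_sphere_wedge [set: V]%SET es ei ec).
suff -> : cliques (indep_graph e [set: V]%SET) = independence_complex e by [].
apply/setP => A; rewrite !inE finset.subsetT /=.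
apply: eq_forallb_in => x _; apply: eq_forallb_in => y _.
by apply: compat_link => [z|z t] /=; rewrite ?ei // es.
Qed.
End AttachedSpheres.

Theorem proposition3p12 (R : realType) (V : finType) (e : rel V)
    (esym : symmetric e) (eirr : irreflexive e) (ecactus : cactus e) :
  circle_graph R e /\
  exists W : topologicalType, wedge_of_spheres R W /\
    homotopy_equivalent R
      (geometric_realization R (independence_complex e)) W.
Proof.
split; first exact: cactus_circle_graph.
exact: cactus_independence_complex.
Qed.
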